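(* There exist constants $C_0>1$ and $0<\epsilon_0<\frac12$ such that for every $p$ with $\frac12<p\le\frac12+\epsilon_0$ and every positive integer $M$ with $M(2p-1)\ge C_0$, the excited random walk starting at $(0,\omega^{M,p})$ has strictly positive speed, i.e. the almost sure limit $\lim_{n\to\infty}X_n/n$ is strictly positive.
   Context: $\mathbb{N}=\{1,2,\dots\}$. An environment is $\omega=(\omega(x,n))_{x\in\mathbb{Z},\,n\in\mathbb{N}}$ with $\omega(x,n)\in[1/2,1]$. The excited random walk (ERW) on $\mathbb{Z}$ started at $(x_0,\omega)$ is the process with $X_0=x_0$ which, whenever it is at a site $x$ for the $n$-th time (time $0$ included), jumps next to $x+1$ with probability $\omega(x,n)$ and to $x-1$ with probability $1-\omega(x,n)$, given the past. For $p>1/2$ and $M\in\mathbb{N}$, $\omega^{M,p}$ is the homogeneous environment with $M$ cookies of intensity $p$ per site: $\omega^{M,p}(x,n)=p$ for $n\le M$ and $\omega^{M,p}(x,n)=1/2$ for $n>M$, for every $x\in\mathbb{Z}$. It is known (Zerner) that for this environment the limit $\lim_{n\to\infty}X_n/n$ exists almost surely and is a deterministic constant, called the speed. *)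

(* Defs.v *)
From HB Require Import structures.
From mathcomp Require Import all_boot all_order all_algebra.
From mathcomp Require Import all_classical all_reals all_analysis.
Set Implicit Arguments.
Unset Strict Implicit.
Unset Printing Implicit Defensive.
Import Order.TTheory GRing.Theory Num.Theory.
Import numFieldNormedType.Exports.
Local Open Scope classical_set_scope.
Local Open Scope ring_scope.

(* [omega x n] is the cookie used at the [n]-th visit to [x]; visits are
   numbered from 1, so the value at [n = 0] is irrelevant. *)
Definition cookie_env (R : realType) := int -> nat -> R.

Definition admissible (R : realType) (omega : cookie_env R) : Prop :=
  forall x n, (0 < n)%N -> 1 / 2 <= omega x n <= 1.

Definition homogeneous_env (R : realType) (M : nat) (p : R) : cookie_env R :=
  fun _ n => if (n <= M)%N then p else 1 / 2.

Lemma homogeneous_env_admissible (R : realType) (M : nat) (p : R) :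
  1 / 2 <= p <= 1 -> admissible (homogeneous_env M p).
Proof.
move=> hp x n _; rewrite /homogeneous_env; case: ifP => // _.
by case/andP: hp => h1 h2; rewrite lexx (le_trans h1 h2).
Qed.

(* Number of times [k <= n], time 0 included, at which [x] is at [x n]. *)
Definition visits (x : nat -> int) (n : nat) : nat :=
  count_mem (x n) (mkseq x n.+1).

Definition past (T : Type) (X : nat -> T -> int) (n : nat) (x : nat -> int)
    : set T :=
  [set t | forall k, (k <= n)%N -> X k t = x k].

(* The past takes countably many values, so the conditional law of the next
   step is prescribed on each atom of the past; the product form imposes
   nothing on atoms of probability 0. There is no measurable structure on
   [int] in the library, hence the first field. *)
Record excited_random_walk (d : measure_display) (T : measurableType d)
    (R : realType) (P : probability T R) (x0 : int) (omega : cookie_env R)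
    (X : nat -> T -> int) : Prop := ExcitedRandomWalk {
  erw_measurable : forall n z, measurable (X n @^-1` [set z]);
  erw_start : P [set t | X 0%N t = x0] = 1%E;
  erw_right : forall n x,
    P (past X n x `&` [set t | X n.+1 t = x n + 1]) =
    ((omega (x n) (visits x n))%:E * P (past X n x))%E;
  erw_left : forall n x,
    P (past X n x `&` [set t | X n.+1 t = x n - 1]) =
    ((1 - omega (x n) (visits x n))%:E * P (past X n x))%E
}.

Definition has_speed (d : measure_display) (T : measurableType d)
    (R : realType) (P : probability T R) (X : nat -> T -> int) (v : R) : Prop :=
  {ae P, forall t, (fun n => (X n t)%:~R / n%:R : R) @ \oo --> v}.

(* Main.v *)
Require Import Defs.
From HB Require Import structures.
From mathcomp Require Import all_boot all_order all_algebra.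
From mathcomp Require Import all_classical all_reals all_analysis.
From mathcomp Require Import ring lra zify.
Set Implicit Arguments.
Unset Strict Implicit.
Unset Printing Implicit Defensive.
Import Order.TTheory GRing.Theory Num.Theory.
Import numFieldNormedType.Exports.
Local Open Scope classical_set_scope.
Local Open Scope ring_scope.

(** Let T_n be the first time at which the walk is at n, and let D_k be the
    number of jumps from k to k - 1 before T_n, so that T_n = n + 2 sum_k D_k.
    The theorem follows from T_n / n -> c for a finite constant c: a walk with
    unit steps then has X_t / t -> 1 / c.

    Read from n downwards, the D_k form a Markov chain.  Before T_n a site k
    with 0 <= k < n is left to the right D_{k+1} + 1 times, and a site k < 0 is
    left to the right D_{k+1} times; hence D_k is the number of failures before
    the (D_{k+1} + 1)-st, respectively D_{k+1}-th, success in a sequence of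
    trials whose first M success probabilities are p and the others 1/2.
    Without cookies this would be critical branching with one immigrant; the
    cookies lower the conditional mean by M (2 p - 1) as soon as all of them
    are used.  When M (2 p - 1) >= 10 this drift beats the immigrant and the
    second-order terms even for sixth powers: [Pr_shift6] shows that
    W(z) = (z + 100)^6 satisfies PW <= W - (z + 100)^5 + b, and [exists_lyap]
    extracts a quadratic function V with PV <= V - z away from 0.

    Let mu n be the expected sum of the first n values of the chain started at
    0.  The chain is stochastically monotone, so these values have increasing
    means; the means are bounded, hence mu n / n converges ([mean_cvg]).  The
    expected sum of the future values depends on the present value z by at most
    V(z), and E V^2 is controlled by W, so the sum has variance O(n).  The same
    function V bounds the expected number of left jumps from negative sites,
    uniformly in n.  These estimates are collected in [fresh_bounds].

    The chain is carried back to the walk by a harmonic function instead of an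
    array of coins: [Esites] is the value, computed by the chain, of the
    conditional expectation of a function of the D_k given the present position
    and the numbers of visits so far.  It is preserved by one step of the walk
    ([Esites_step]), so an induction on the time that remains gives a Chebyshev
    bound ([untimely_le]): the probability that no visit to n takes place within
    eps n of time n + 2 mu n is O(1/n).  Along the squares this is summable,
    Borel-Cantelli applies, and the unit steps of the walk fill the gaps between
    consecutive squares ([speed_of_crossings]). *)

(** * Failures before the r-th success *)

Section failures.
Context {R : realType} (q : nat -> R).
Hypothesis q01 : forall c, 1 / 2 <= q c <= 1.

(** [fail_pmf r c j] is the probability of exactly j failures before the r-th
    success in independent trials numbered c, c + 1, ..., the k-th trial being
    a success with probability [q k].  The first trial is resolved at each call:
    a success decreases r, a failure decreases j. *)
Fixpoint fail_pmf (r : nat) : nat -> nat -> R :=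
  if r is r'.+1 then
    fix aux (c j : nat) {struct j} : R :=
      if j is j'.+1 then q c * fail_pmf r' c.+1 j + (1 - q c) * aux c.+1 j'
      else q c * fail_pmf r' c.+1 0
  else fun c j => (j == 0)%:R.

Let q0 c : 0 <= q c. Proof. by have := q01 c; lra. Qed.
Let q1 c : 0 <= 1 - q c. Proof. by have := q01 c; lra. Qed.
Let q0E c : (0 <= (q c)%:E)%E. Proof. by rewrite lee_fin. Qed.
Let q1E c : (0 <= (1 - q c)%:E)%E. Proof. by rewrite lee_fin. Qed.

Lemma fail_pmf_ge0 r c j : 0 <= fail_pmf r c j.
Proof.
elim: r c j => [|r IHr] c j /=; first by case: eqP.
elim: j c => [|j IHj] c; first by rewrite mulr_ge0.
by rewrite addr_ge0 ?mulr_ge0.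
Qed.

Local Open Scope ereal_scope.

Definition Efail (c r : nat) (f : nat -> \bar R) : \bar R :=
  \sum_(0 <= j <oo) (fail_pmf r c j)%:E * f j.

Let term_ge0 r c j x : 0 <= x -> 0 <= (fail_pmf r c j)%:E * x.
Proof. by move=> x0; rewrite mule_ge0// lee_fin fail_pmf_ge0. Qed.

Lemma Efail_ge0 c r f : (forall j, 0 <= f j) -> 0 <= Efail c r f.
Proof. by move=> f0; apply: nneseries_ge0 => j _ _; exact: term_ge0. Qed.

Lemma le_Efail c r f g : (forall j, 0 <= f j) -> (forall j, f j <= g j) ->
  Efail c r f <= Efail c r g.
Proof.
move=> f0 fg; apply: lee_nneseries => [j _ _|j _]; first exact: term_ge0.
by rewrite lee_wpmul2l// lee_fin fail_pmf_ge0.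
Qed.

Lemma eq_Efail c r f g : f =1 g -> Efail c r f = Efail c r g.
Proof. by move=> /funext ->. Qed.

Lemma EfailD c r f g : (forall j, 0 <= f j) -> (forall j, 0 <= g j) ->
  Efail c r (fun j => f j + g j) = Efail c r f + Efail c r g.
Proof.
move=> f0 g0; rewrite /Efail -nneseriesD => [|j _ _|j _ _]; try exact: term_ge0.
by apply: eq_eseriesr => j _; rewrite ge0_muleDr.
Qed.

Lemma EfailZ c r a f : (forall j, 0 <= f j) ->
  Efail c r (fun j => a%:E * f j) = a%:E * Efail c r f.
Proof.
move=> f0; rewrite /Efail -nneseriesZl => [|j _]; last exact: term_ge0.
by apply: eq_eseriesr => j _; rewrite muleCA.
Qed.

Lemma Efail0 c f : (forall j, 0 <= f j) -> Efail c 0 f = f 0%N.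
Proof.
move=> f0; rewrite /Efail nneseries_recl// => [|j _]; last exact: term_ge0.
by rewrite mul1e eseries0 ?adde0// => -[|i]//= _ _; rewrite mul0e.
Qed.

(** Conditioning on the outcome of the first trial. *)
Lemma EfailS c r f : (forall j, 0 <= f j) ->
  Efail c r.+1 f =
  (q c)%:E * Efail c.+1 r f + (1 - q c)%:E * Efail c.+1 r.+1 (f \o succn).
Proof.
move=> f0.
have recl r' c' : Efail c' r' f = (fail_pmf r' c' 0)%:E * f 0%N +
    \sum_(0 <= j <oo) (fail_pmf r' c' j.+1)%:E * f j.+1.
  rewrite /Efail nneseries_recl// => [|j _]; last exact: term_ge0.
  rewrite -nneseries_addn; last by move=> j; exact: term_ge0.
  by congr (_ + _); apply: eq_eseriesr => j _; rewrite addn1.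
rewrite !recl /Efail ge0_muleDr; last 2 first.
- exact: term_ge0.
- by apply: nneseries_ge0 => j _ _; exact: term_ge0.
rewrite EFinM muleA -addeA; congr (_ + _).
rewrite -!nneseriesZl; last 2 first.
- by move=> j _; apply: (term_ge0 r.+1); exact: f0.
- by move=> j _; apply: term_ge0; exact: f0.
rewrite -nneseriesD => [|j _ _|j _ _]; last 2 first.
- by rewrite mule_ge0// term_ge0.
- by rewrite mule_ge0// (term_ge0 r.+1)//; exact: f0.
apply: eq_eseriesr => j _; rewrite !muleA -!EFinM -ge0_muleDl.
- by rewrite -EFinD.
- by rewrite lee_fin mulr_ge0// fail_pmf_ge0.
- by rewrite lee_fin mulr_ge0// (fail_pmf_ge0 r.+1).
Qed.

(** [Efail] is the least non-negative solution of its one-step recursion, since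
    every partial sum of the series lies below every supersolution.  Upper
    bounds and stochastic monotonicity are obtained by exhibiting a
    supersolution; c0 allows one that works only after the cookies. *)
Lemma Efail_least c0 (U : nat -> nat -> nat -> \bar R) (f : nat -> \bar R) :
    (forall j, 0 <= f j) -> (forall c r j, 0 <= U c r j) ->
    (forall c j, (c0 <= c)%N -> f j <= U c 0%N j) ->
    (forall c r j, (c0 <= c)%N ->
      (q c)%:E * U c.+1 r j + (1 - q c)%:E * U c.+1 r.+1 j.+1 <= U c r.+1 j) ->
  forall c r j, (c0 <= c)%N -> Efail c r (fun i => f (j + i)%N) <= U c r j.
Proof.
move=> f0 U0 Uf UU c r j c0c; apply: lime_le.
  by apply: is_cvg_nneseries => *; exact: term_ge0.
apply: nearW => J; elim: J c r j c0c => [|J IHJ] c r j c0c.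
  by rewrite big_geq.
elim: r c c0c => [|r IHr] c c0c.
  rewrite big_nat_recl//= mul1e addn0 big1 ?adde0 ?Uf// => i _.
  by rewrite mul0e.
apply: le_trans (UU _ _ _ c0c).
apply: (@le_trans _ _ ((q c)%:E *
    (\sum_(0 <= k < J.+1) (fail_pmf r c.+1 k)%:E * f (j + k)%N) +
    (1 - q c)%:E *
    (\sum_(0 <= k < J) (fail_pmf r.+1 c.+1 k)%:E * f (j.+1 + k)%N))); last first.
  by apply: leeD; apply: lee_wpmul2l => //; [apply: IHr|apply: IHJ]; exact: leqW.
rewrite !big_nat_recl// ge0_muleDr//; last 2 first.
- exact: term_ge0.
- by apply: sume_ge0 => k _; apply: term_ge0.
rewrite /= EFinM muleA -addeA leeD2l//.
rewrite !ge0_sume_distrr; last 2 first.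
- by move=> k _; apply: (term_ge0 r.+1).
- by move=> k _; apply: (term_ge0 r).
rewrite -big_split/=; apply: lee_sum => k _.
rewrite addSnnS !muleA -!EFinM -ge0_muleDl -?EFinD//.
- by rewrite lee_fin mulr_ge0// fail_pmf_ge0.
- by rewrite lee_fin mulr_ge0// (fail_pmf_ge0 r.+1).
Qed.

(** The r-th success occurs almost surely: as long as it is missing, the missing
    mass is at least halved by each trial because [q c >= 1 / 2]. *)
Lemma Efail1 c r : Efail c r (fun=> 1) = 1.
Proof.
have le1 c' r' : Efail c' r' (fun=> 1) <= 1.
  apply: (@Efail_least 0 (fun _ _ _ => 1) (fun=> 1) _ _ _ _ c' r' 0%N) => //.
  by move=> k s j _; rewrite !mule1 -EFinD addrC subrK.
apply/eqP; rewrite eq_le le1/=.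
elim: r c => [|r IHr] c; first by rewrite Efail0.
have {}IHr c' : Efail c' r (fun=> 1) = 1 by apply/eqP; rewrite eq_le le1 IHr.
have ge i c' : (1 - 2^-1 ^+ i)%:E <= Efail c' r.+1 (fun=> 1).
  elim: i c' => [|i IHi] c'; first by rewrite expr0 subrr Efail_ge0.
  rewrite EfailS// IHr mule1.
  apply: (@le_trans _ _ ((q c')%:E + (1 - q c')%:E * (1 - 2^-1 ^+ i)%:E)); last first.
    by rewrite leeD2l// lee_wpmul2l.
  rewrite -EFinM -EFinD lee_fin exprS.
  have : (0 <= 2^-1 ^+ i :> R)%R by rewrite exprn_ge0// invr_ge0.
  by have := q01 c'; nra.
have fin : Efail c r.+1 (fun=> 1) \is a fin_num.
  rewrite ge0_fin_numE ?Efail_ge0//; exact: le_lt_trans (le1 _ _) (ltry _).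
rewrite -(fineK fin) lee_fin; apply/ler_addgt0Pr => e e0.
have [i Hi] : exists i, (2^-1 ^+ i <= e :> R)%R.
  have /cvgrPdist_lt/(_ e e0) [i _ /(_ i (leqnn _))] :
      ((2^-1 : R) ^+ n @[n --> \oo] --> (0 : R))%R.
    by apply: cvg_expr; rewrite ger0_norm ?invr_ge0// invf_lt1// ltr1n.
  rewrite /= sub0r normrN ger0_norm ?exprn_ge0 ?invr_ge0// => /ltW ?; by exists i.
by have := ge i c; rewrite -(fineK fin) lee_fin; lra.
Qed.

Lemma Efail_cst c r (a : R) : (0 <= a)%R -> Efail c r (fun=> a%:E) = a%:E.
Proof.
move=> a0; rewrite (_ : (fun=> a%:E) = (fun=> a%:E * 1)); last first.
  by apply/funext => j; rewrite mule1.
by rewrite EfailZ// Efail1 mule1.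
Qed.

(** The expectation for one more success is a supersolution of the recursion
    for [Efail _ r]: a further wait can only add failures. *)
Lemma Efail_leS c r (f : nat -> R) : (forall j, (0 <= f j)%R) ->
  {homo f : i j / (i <= j)%N >-> (i <= j)%R} ->
  Efail c r (EFin \o f) <= Efail c r.+1 (EFin \o f).
Proof.
move=> f0 homof; have f0E j i : 0 <= (f (j + i)%N)%:E by rewrite lee_fin.
apply: (@Efail_least 0 (fun c r j => Efail c r.+1 (fun i => (f (j + i)%N)%:E))
  (EFin \o f) _ _ _ _ c r 0%N) => //=.
- by move=> *; exact: Efail_ge0.
- move=> k j _; rewrite -[leLHS](@Efail_cst k 1)//.
  apply: le_Efail => // i; rewrite lee_fin//.
  by apply: homof; exact: leq_addr.
- move=> k s j _.
  rewrite (_ : (fun i => (f (j.+1 + i)%N)%:E) =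
    (fun i => (f (j + i)%N)%:E) \o succn); last first.
    by apply/funext => i /=; rewrite addSnnS.
  by rewrite -EfailS.
Qed.

Lemma fail_pmf0_ge c r : (2^-1 ^+ r <= fail_pmf r c 0)%R.
Proof.
elim: r c => [|r IHr] c //=; rewrite exprS ler_pM ?invr_ge0 ?exprn_ge0 ?invr_ge0//.
by have := q01 c; lra.
Qed.

Lemma Efail_pos c r :
  Efail c r (fun j => ((0 < j)%N%:R)%:E) + (fail_pmf r c 0)%:E = 1.
Proof.
rewrite -[RHS](@Efail1 c r) /Efail.
rewrite [LHS]addeC nneseries_recl// => [|j _]; last by rewrite term_ge0 ?lee_fin.
rewrite [RHS]nneseries_recl//= => [|j _]; last by rewrite term_ge0.
rewrite mule0 add0e mule1; congr (_ + _).
rewrite -[LHS](@nneseries_addn _ _ 1); last first.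
  by move=> i; rewrite term_ge0 ?lee_fin.
rewrite -[RHS](@nneseries_addn _ _ 1); last by move=> i; rewrite term_ge0.
by apply: eq_eseriesr => i _; rewrite addn1.
Qed.

End failures.

(** * Moments of the number of failures *)

(** One fair trial does not increase y^6 + 40 y^4 r, where y stands for the
    number of failures plus the number r of missing successes, plus 100.  The
    variable y makes a symmetric unit step; the resulting 15 y^4 is paid for by
    the second term, which loses about 20 y^4 because r decreases with
    probability 1/2.  The shift by 100 makes y large enough to hide the lower
    order terms. *)
Lemma cookieless_step_le (R : realFieldType) (y r : R) : 0 <= r -> r + 101 <= y ->
  1/2 * ((y - 1) ^+ 6 + 40 * (y - 1) ^+ 4 * r) +
  (1 - 1/2) * ((y + 1) ^+ 6 + 40 * (y + 1) ^+ 4 * (r + 1)) <=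
  y ^+ 6 + 40 * y ^+ 4 * (r + 1).
Proof.
move=> r0 ry; have y0 : 101 <= y by lra.
have h1 : 0 <= (6 * y ^+ 2 + 1) * (y - r).
  by rewrite mulr_ge0//; have := sqr_ge0 y; lra.
have pw k : 0 <= y ^+ k * (y - 101) by rewrite mulr_ge0 ?exprn_ge0//; lra.
have := pw 3; have := pw 2; have := pw 1; lra.
Qed.
(** The trials with cookies: y makes a unit step with mean - (2 p - 1).  The next
    four inequalities expand the terms of the bound in [E6_cookies]. *)
Lemma cookie_step6_le (R : realFieldType) (p y : R) : 1 <= y -> 1 / 2 <= p <= 1 ->
  p * (y - 1) ^+ 6 + (1 - p) * (y + 1) ^+ 6 <=
  y ^+ 6 - 6 * (2 * p - 1) * y ^+ 5 + 31 * y ^+ 4.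
Proof.
move=> y1 /andP[p1 p2].
have pw k : 0 <= y ^+ k * (y - 1) by rewrite mulr_ge0 ?exprn_ge0//; lra.
have y0 k : 0 <= y ^+ k by rewrite exprn_ge0//; lra.
have py k : 0 <= (2 * p - 1) * y ^+ k by rewrite mulr_ge0//; lra.
have := pw 3; have := pw 2; have := pw 1; have := pw 0; have := py 1; have := py 3; lra.
Qed.
Lemma cookie_step5_ge (R : realFieldType) (p y : R) : 1 <= y -> 1 / 2 <= p <= 1 ->
  y ^+ 5 - 5 * y ^+ 4 <= p * (y - 1) ^+ 5 + (1 - p) * (y + 1) ^+ 5.
Proof.
move=> y1 /andP[p1 p2].
have pw k : 0 <= y ^+ k * (y - 1) by rewrite mulr_ge0 ?exprn_ge0//; lra.
have y0 k : 0 <= y ^+ k by rewrite exprn_ge0//; lra.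
have py k : 0 <= (1 - p) * y ^+ k by rewrite mulr_ge0//; lra.
have := pw 3; have := pw 2; have := pw 1; have := pw 0; have := py 0;
have := py 2; have := py 4; have := y0 3; lra.
Qed.
Lemma cookie_step4w_le (R : realFieldType) (p y r : R) :
  1 <= y -> 1 / 2 <= p <= 1 -> 0 <= r -> r + 1 <= y ->
  p * ((y - 1) ^+ 4 * r) + (1 - p) * ((y + 1) ^+ 4 * (r + 1)) <=
  y ^+ 4 * (r + 1) + 15 * y ^+ 4.
Proof.
move=> y1 /andP[p1 p2] r0 r1.
have pw k : 0 <= y ^+ k * (y - 1) by rewrite mulr_ge0 ?exprn_ge0//; lra.
have h4 : (y + 1) ^+ 4 <= y ^+ 4 + 15 * y ^+ 3.
  by have := pw 2; have := pw 1; have := pw 0; lra.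
have h : (y - 1) ^+ 4 * r <= (y + 1) ^+ 4 * (r + 1).
  by rewrite ler_pM ?exprn_ge0 ?lerXn2r ?nnegrE//; lra.
have h' : (y + 1) ^+ 4 * (r + 1) <= (y ^+ 4 + 15 * y ^+ 3) * (r + 1).
  by rewrite ler_wpM2r//; lra.
have h'' : y ^+ 3 * (r + 1) <= y ^+ 3 * y by rewrite ler_wpM2l ?exprn_ge0//; lra.
have : p * ((y - 1) ^+ 4 * r) <= p * ((y + 1) ^+ 4 * (r + 1)).
  by rewrite ler_wpM2l//; lra.
lra.
Qed.
Lemma cookie_step4_le (R : realFieldType) (p y : R) : 1 <= y -> 1 / 2 <= p <= 1 ->
  p * (y - 1) ^+ 4 + (1 - p) * (y + 1) ^+ 4 <= 16 * y ^+ 4.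
Proof.
move=> y1 /andP[p1 p2].
have pw k : 0 <= y ^+ k * (y - 1) by rewrite mulr_ge0 ?exprn_ge0//; lra.
have y0 k : 0 <= y ^+ k by rewrite exprn_ge0//; lra.
have py k : 0 <= (2 * p - 1) * y ^+ k by rewrite mulr_ge0//; lra.
have := pw 3; have := pw 2; have := pw 1; have := pw 0; have := py 1; have := py 3; lra.
Qed.

Section drift.
Context {R : realType} (M : nat) (p : R).
Hypothesis p01 : 1 / 2 <= p <= 1.

Definition cookie (c : nat) : R := if (c < M)%N then p else 1 / 2.

Lemma cookie01 c : 1 / 2 <= cookie c <= 1.
Proof. by rewrite /cookie; case: ifP => // _; lra. Qed.

#[local] Hint Resolve cookie01 : core.

(** Powers of z + 100 replace powers of z in all moment bounds, so that lower
    order terms can be absorbed without treating small z separately. *)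
Definition shift (z : nat) : R := z%:R + 100.

Lemma shift_ge1 z : 1 <= shift z.
Proof. by rewrite /shift; have : 0 <= z%:R :> R by []; lra. Qed.

Lemma shift_ge0 z : 0 <= shift z.
Proof. exact: le_trans (shift_ge1 z). Qed.

Lemma shiftX_ge0 z k : 0 <= shift z ^+ k.
Proof. by rewrite exprn_ge0// shift_ge0. Qed.

Local Notation E6 c r j :=
  (Efail cookie c r (fun i => (shift (j + i)%N ^+ 6)%:E)).

(** The supersolution is the function of [cookieless_step_le]. *)
Lemma E6_cookieless c r j : (M <= c)%N ->
  (E6 c r j <= (shift (j + r)%N ^+ 6 + 40 * shift (j + r)%N ^+ 4 * r%:R)%:E)%E.
Proof.
have sE i k : shift (i + k.+1)%N = shift (i + k)%N + 1.
  by rewrite /shift addnS -natr1 addrAC.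
move=> Mc; apply: (@Efail_least _ cookie cookie01 M
  (fun _ r j => (shift (j + r)%N ^+ 6 + 40 * shift (j + r)%N ^+ 4 * r%:R)%:E)
  (fun i => (shift i ^+ 6)%:E)) => //= [i|_ s i|_ i _|k s i Mk].
- by rewrite lee_fin shiftX_ge0.
- by rewrite lee_fin addr_ge0 ?mulr_ge0 ?shift_ge0.
- by rewrite addn0 mulr0 addr0.
rewrite /cookie ltnNge Mk/= -!EFinM -EFinD lee_fin.
have -> : shift (i + s)%N = shift (i + s.+1)%N - 1 by rewrite sE addrK.
rewrite addSn -addnS (sE i s.+1) -(@natr1 _ s); apply: cookieless_step_le => //.
by rewrite sE /shift natrD; have : 0 <= i%:R :> R by []; lra.
Qed.

(** With d cookies left and at least d successes missing, all d cookies are used,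
    and each of them lowers the sixth moment by 6 (2 p - 1) y^5 up to O(y^4). *)
Lemma E6_cookies d : (d <= M)%N -> exists2 C : R, 0 <= C & forall r j,
  (d <= r)%N ->
  (E6 (M - d)%N r j <= (shift (j + r)%N ^+ 6
     - 6 * (2 * p - 1) * d%:R * shift (j + r)%N ^+ 5
     + 40 * shift (j + r)%N ^+ 4 * r%:R + C * shift (j + r)%N ^+ 4)%:E)%E.
Proof.
elim: d => [|d IHd] dM.
  exists 0 => // r j _; rewrite mul0r addr0 mulr0 mul0r subr0 subn0.
  exact: E6_cookieless.
have [C C0 {}IHd] := IHd (ltnW dM).
exists (31 + 30 * d%:R + 600 + 16 * C); first by rewrite !addr_ge0// mulr_ge0.
move=> [//|r] j dr; rewrite EfailS//; last first.
  by move=> i; rewrite lee_fin shiftX_ge0.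
have -> : cookie (M - d.+1)%N = p by rewrite /cookie ltn_subrL (leq_trans _ dM).
rewrite subnSK//.
set y := shift (j + r.+1)%N.
have sE i k : shift (i + k.+1)%N = shift (i + k)%N + 1.
  by rewrite /shift addnS -natr1 addrAC.
have y1 : 1 <= y by exact: shift_ge1.
have ry : r%:R + 1 <= y.
  by rewrite /y sE /shift natrD; have : 0 <= j%:R :> R by []; lra.
have := IHd r j dr; have := IHd r.+1 j.+1 (leqW dr).
rewrite addSn -addnS (sE j r.+1) -/y.
have -> : shift (j + r)%N = y - 1 by rewrite /y sE addrK.
have -> : (fun i => (shift (j.+1 + i) ^+ 6)%:E) =
    (fun i => (shift (j + i)%N ^+ 6)%:E) \o succn.
  by apply/funext => i /=; rewrite addSnnS.
set A := Efail _ _ _ _; set B := Efail _ _ _ _ => HA HB.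
have p0 : 0 <= p by case/andP: p01; lra.
have p1 : 0 <= 1 - p by case/andP: p01; lra.
have eta0 : 0 <= 2 * p - 1 by case/andP: p01; lra.
apply: le_trans.
  by apply: leeD; apply: lee_wpmul2l;
    [rewrite lee_fin|exact: HB|rewrite lee_fin|exact: HA].
rewrite -!EFinM -EFinD lee_fin -(@natr1 _ r) -(@natr1 _ d).
have i1 := cookie_step6_le y1 p01.
have i2 := cookie_step5_ge y1 p01.
have i3 : p * ((y - 1) ^+ 4 * r%:R) + (1 - p) * ((y + 1) ^+ 4 * (r%:R + 1)) <=
  y ^+ 4 * (r%:R + 1) + 15 * y ^+ 4 by apply: cookie_step4w_le.
have i4 := cookie_step4_le y1 p01.
have y4 : 0 <= y ^+ 4 by rewrite exprn_ge0//; lra.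
have {}i2 : (2 * p - 1) * d%:R * (y ^+ 5 - 5 * y ^+ 4) <=
  (2 * p - 1) * d%:R * (p * (y - 1) ^+ 5 + (1 - p) * (y + 1) ^+ 5).
  by rewrite ler_wpM2l// mulr_ge0.
have {}i4 : C * (p * (y - 1) ^+ 4 + (1 - p) * (y + 1) ^+ 4) <= C * (16 * y ^+ 4).
  by rewrite ler_wpM2l.
have i5 : 0 <= (2 - 2 * p) * (d%:R * y ^+ 4) by apply: mulr_ge0; [lra|exact: mulr_ge0].
lra.
Qed.

(** Also when fewer successes are missing than cookies are left: finitely many
    trials lead to the fair regime. *)
Lemma E6_fin c r j : (E6 c r j < +oo)%E.
Proof.
have fin_ge c' r' j' : (M <= c')%N -> (E6 c' r' j' < +oo)%E.
  by move=> Mc; apply: le_lt_trans (E6_cookieless _ _ Mc) _; rewrite ltry.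
suff fin d r' j' : (d <= M)%N -> (E6 (M - d) r' j' < +oo)%E.
  have [/fin_ge//|/ltnW cM] := leqP M c.
  by rewrite -(subKn cM); apply: fin; exact: leq_subr.
elim: d r' j' => [|d IHd] r' j' dM; first by rewrite subn0 fin_ge.
have pos i : (0 <= (shift (j' + i) ^+ 6)%:E)%E by rewrite lee_fin shiftX_ge0.
case: r' => [|r']; first by rewrite Efail0 ?ltry.
rewrite EfailS//.
rewrite subnSK//.
have -> : (fun i => (shift (j' + i)%N ^+ 6)%:E) \o succn =
    (fun i => (shift (j'.+1 + i) ^+ 6)%:E).
  by apply/funext => i /=; rewrite addSnnS.
have /andP[q0 q1] := cookie01 (M - d.+1)%N.
apply: lte_add_pinfty; apply: lte_mul_pinfty => //.
- by rewrite lee_fin; lra.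
- by apply: IHd; exact: ltnW.
- by rewrite lee_fin; lra.
- by apply: IHd; exact: ltnW.
Qed.

End drift.

(** * The chain of left jumps and its Lyapunov functions *)

Section chain.
Context {R : realType} (M : nat) (p : R).
Hypothesis p01 : 1 / 2 <= p <= 1.

Local Notation cookie := (cookie M p).

Let cookie01 : forall c, 1 / 2 <= cookie c <= 1 := cookie01 M p01.
#[local] Hint Resolve cookie01 : core.

(** The class of functions on which the transition operator is finite; it is
    stable under the operator by [tame_Pr]. *)
Definition tame (f : nat -> R) : Prop :=
  exists C, forall z, 0 <= f z <= C * shift z ^+ 6.

Lemma tame_le f g : tame g -> (forall z, 0 <= f z <= g z) -> tame f.
Proof.
move=> [C gC] fg; exists C => z; have /andP[-> /le_trans fz] := fg z.
by apply: fz; have /andP[] := gC z.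
Qed.

Lemma tameD f g : tame f -> tame g -> tame (fun z => f z + g z).
Proof.
move=> [C fC] [D gD]; exists (C + D) => z.
have /andP[f0 fz] := fC z; have /andP[g0 gz] := gD z.
by rewrite addr_ge0//= mulrDl lerD.
Qed.

Lemma tameZ a f : 0 <= a -> tame f -> tame (fun z => a * f z).
Proof.
move=> a0 [C fC]; exists (a * C) => z; have /andP[f0 fz] := fC z.
by rewrite mulr_ge0//= -mulrA ler_wpM2l.
Qed.

Lemma tame_shift k : (k <= 6)%N -> tame (fun z => shift z ^+ k).
Proof.
move=> k6; exists 1 => z; rewrite shiftX_ge0 mul1r/=.
by rewrite ler_weXn2l// shift_ge1.
Qed.

Lemma tame_cst a : 0 <= a -> tame (fun=> a).
Proof.
move=> a0; apply: (tame_le (tameZ a0 (tame_shift (leq0n 6)))) => z.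
by rewrite expr0 mulr1 a0 lexx.
Qed.

Lemma tame_nat : tame (fun z => z%:R).
Proof.
apply: (tame_le (tame_shift (isT : (1 <= 6)%N))) => z.
by rewrite ler0n/= expr1 /shift lerDl ler0n.
Qed.

Lemma tame_ge0 f z : tame f -> 0 <= f z.
Proof. by case=> C /(_ z)/andP[]. Qed.

Let tame_ge0E f z : tame f -> (0 <= (EFin \o f) z)%E.
Proof. by move=> /tame_ge0 ?; rewrite lee_fin. Qed.

Lemma Efail_tame f c r : tame f -> Efail cookie c r (EFin \o f) \is a fin_num.
Proof.
move=> tf; have [C fC] := tf.
have C0 : 0 <= C.
  have /andP[/le_trans h /h] := fC 0%N.
  by rewrite pmulr_lge0// exprn_gt0// (lt_le_trans ltr01)// shift_ge1.
rewrite ge0_fin_numE; last first.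
  by apply: (Efail_ge0 cookie01) => j; exact: tame_ge0E.
apply: (@le_lt_trans _ _
    (C%:E * Efail cookie c r (fun i => (shift (0 + i)%N ^+ 6)%:E))%E).
  rewrite -EfailZ//; last by move=> j; rewrite lee_fin shiftX_ge0.
  apply: (le_Efail cookie01) => j; first exact: tame_ge0E.
  by rewrite -EFinM lee_fin; have /andP[] := fC j.
by apply: lte_mul_pinfty; rewrite ?lee_fin//; exact: E6_fin.
Qed.

(** Transition operator of the chain at sites that have an immigrant: from z,
    wait for z + 1 successes. *)
Definition Pr (f : nat -> R) (z : nat) : R :=
  fine (Efail cookie 0 z.+1 (EFin \o f)).

Lemma PrE f z : tame f -> Efail cookie 0 z.+1 (EFin \o f) = (Pr f z)%:E.
Proof. by move=> tf; rewrite /Pr fineK// Efail_tame. Qed.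

Lemma le_Pr f g z : tame f -> tame g -> (forall j, f j <= g j) ->
  Pr f z <= Pr g z.
Proof.
move=> tf tg fg; rewrite -lee_fin -!PrE//; apply: (le_Efail cookie01) => j.
  exact: tame_ge0E.
by rewrite lee_fin.
Qed.

Lemma PrD f g z : tame f -> tame g -> Pr (fun j => f j + g j) z = Pr f z + Pr g z.
Proof.
move=> tf tg; apply: EFin_inj; rewrite EFinD -!PrE//; last exact: tameD.
by rewrite -EfailD// => j; exact: tame_ge0E.
Qed.

Lemma PrZ a f z : 0 <= a -> tame f -> Pr (fun j => a * f j) z = a * Pr f z.
Proof.
move=> a0 tf; apply: EFin_inj; rewrite EFinM -!PrE//; last exact: tameZ.
by rewrite -EfailZ// => j; exact: tame_ge0E.
Qed.

Lemma Pr_cst a z : 0 <= a -> Pr (fun=> a) z = a.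
Proof. by move=> a0; rewrite /Pr [Efail _ _ _ _]Efail_cst. Qed.

Lemma eq_Pr f g z : f =1 g -> Pr f z = Pr g z.
Proof. by move=> /funext ->. Qed.

Lemma Pr_ge0 f z : tame f -> 0 <= Pr f z.
Proof.
move=> tf; rewrite -(@Pr_cst 0 z)//; apply: le_Pr => // [|j].
  exact: tame_cst.
exact: tame_ge0.
Qed.

Lemma Pr_homo f : tame f -> {homo f : i j / (i <= j)%N >-> i <= j} ->
  {homo Pr f : i j / (i <= j)%N >-> i <= j}.
Proof.
move=> tf hf; apply/nondecreasing_seqP => z; rewrite -lee_fin -!PrE//.
by apply: Efail_leS => // j; exact: tame_ge0.
Qed.

Hypothesis drift10 : 10 <= M%:R * (2 * p - 1).

Lemma finite_bound (F : nat -> R) n : exists2 B, 0 <= B & forall z, (z < n)%N -> F z <= B.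
Proof.
exists (\sum_(i < n) `|F i|) => [|z zn]; first exact: sumr_ge0.
rewrite (bigD1 (Ordinal zn))//=; apply: le_trans (ler_norm _) _.
by rewrite lerDl sumr_ge0.
Qed.

(** With w = z + 100 the cookies contribute at most - 60 w^5, the variance of the
    fair trials 40 w^5 and the immigrant 6 w^5, up to O(w^4). *)
Lemma Pr_shift6_far : exists z0, forall z, (z0 <= z)%N ->
  Pr (fun j => shift j ^+ 6) z <= shift z ^+ 6 - shift z ^+ 5.
Proof.
have [C C0 HC] := E6_cookies p01 (leqnn M).
exists (maxn M (Num.truncn (57 + 16 * C)).+1) => z; rewrite geq_max => /andP[Mz Cz].
rewrite -lee_fin -PrE; last exact: tame_shift.
have := HC z.+1 0%N (leqW Mz); rewrite subnn => /le_trans; apply.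
have -> : shift (0 + z.+1)%N = shift z + 1 :> R.
  by rewrite /shift add0n -(@natr1 _ z) addrAC.
have : 57 + 16 * C <= shift z :> R.
  have /ltW : 57 + 16 * C < z%:R by rewrite -truncn_lt_nat ?addr_ge0 ?mulr_ge0.
  by rewrite /shift; lra.
have : z.+1%:R <= shift z + 1 :> R.
  by rewrite /shift -(@natr1 _ z); lra.
have := @shift_ge1 R z; move: (shift z : R) (z.+1%:R : R) => w r w1 rw Cw.
rewrite lee_fin.
have w0 k : 0 <= w ^+ k by rewrite exprn_ge0//; lra.
have v0 k : 0 <= (w + 1) ^+ k by rewrite exprn_ge0//; lra.
have h1 : 10 * (w + 1) ^+ 5 <= M%:R * (2 * p - 1) * (w + 1) ^+ 5.
  by rewrite ler_wpM2r.
have h2 : (w + 1) ^+ 4 * r <= (w + 1) ^+ 4 * (w + 1) by rewrite ler_wpM2l.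
have pw k : 0 <= w ^+ k * (w - 1) by rewrite mulr_ge0//; lra.
have h3 : (w + 1) ^+ 4 <= 16 * w ^+ 4.
  by have := pw 3; have := pw 2; have := pw 1; have := pw 0; lra.
have {}h3 : C * (w + 1) ^+ 4 <= C * (16 * w ^+ 4) by rewrite ler_wpM2l.
have h4 : (w + 1) ^+ 6 <= w ^+ 6 + 6 * w ^+ 5 + 57 * w ^+ 4.
  by have := pw 3; have := pw 2; have := pw 1; have := pw 0; lra.
have h5 : w ^+ 5 <= (w + 1) ^+ 5 by rewrite lerXn2r ?nnegrE//; lra.
have h6 : (57 + 16 * C) * w ^+ 4 <= w * w ^+ 4 by rewrite ler_wpM2r.
have := w0 5; lra.
Qed.

Lemma Pr_shift6 : exists2 b, 0 <= b & forall z,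
  Pr (fun j => shift j ^+ 6) z <= shift z ^+ 6 - shift z ^+ 5 + b.
Proof.
have [z0 far] := Pr_shift6_far.
have [b b0 near] := finite_bound (fun z =>
  Pr (fun j => shift j ^+ 6) z - shift z ^+ 6 + shift z ^+ 5) z0.
exists b => // z; have [/far|/near] := leqP z0 z; lra.
Qed.

(** The drift of the sixth power absorbs the expectation of the fourth power
    after a step: with u = (j + 100)^2 and v = (z + 100)^2,
    3 u^2 v <= 2 u^3 + v^3 reduces the fourth power to the sixth. *)
Lemma Pr_shift4_shift6 : exists2 b, 0 <= b & forall z,
  Pr (fun j => shift j ^+ 4) z + Pr (fun j => shift j ^+ 6) z <= shift z ^+ 6 + b.
Proof.
have [b b0 drift] := Pr_shift6; exists (2 * b); first by rewrite mulr_ge0.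
move=> z; have := drift z; set w : R := shift z.
have w1 : 1 <= w by exact: shift_ge1.
have w0 : 0 < w by lra.
have t6 : tame (fun j => shift j ^+ 6) by exact: tame_shift.
have : Pr (fun j => shift j ^+ 4) z <=
    Pr (fun j => 2 / 3 * w ^- 2 * shift j ^+ 6 + w ^+ 4 / 3) z.
  apply: le_Pr; first exact: tame_shift.
    apply: tameD; [apply: tameZ => //|apply: tame_cst];
    by rewrite ?mulr_ge0 ?invr_ge0 ?exprn_ge0//; lra.
  move=> j; rewrite -(ler_pM2l (exprn_gt0 2 w0)) mulrDr.
  rewrite [X in _ <= X + _](_ : _ = 2 / 3 * shift j ^+ 6); last first.
    by field; rewrite lt0r_neq0.
  rewrite -subr_ge0.
  have -> : 2 / 3 * shift j ^+ 6 + w ^+ 2 * (w ^+ 4 / 3) - w ^+ 2 * shift j ^+ 4 =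
    (shift j ^+ 2 - w ^+ 2) ^+ 2 * (2 * shift j ^+ 2 + w ^+ 2) / 3 by field.
  apply: divr_ge0 => //; apply: mulr_ge0; first exact: sqr_ge0.
  by have := sqr_ge0 (shift j : R); have := sqr_ge0 w; lra.
rewrite PrD; last 2 first.
- by apply: tameZ => //; rewrite !mulr_ge0 ?invr_ge0 ?exprn_ge0//; lra.
- by apply: tame_cst; rewrite mulr_ge0 ?invr_ge0 ?exprn_ge0//; lra.
rewrite PrZ//; last by rewrite !mulr_ge0 ?invr_ge0 ?exprn_ge0//; lra.
rewrite Pr_cst; last by rewrite mulr_ge0 ?invr_ge0 ?exprn_ge0//; lra.
set A := Pr _ z; set B := Pr _ z => hA hB.
have : w ^- 2 * B <= w ^- 2 * (w ^+ 6 - w ^+ 5 + b).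
  by rewrite ler_wpM2l// invr_ge0 exprn_ge0// ltW.
have -> : w ^- 2 * (w ^+ 6 - w ^+ 5 + b) = w ^+ 4 - w ^+ 3 + w ^- 2 * b.
  by field; rewrite lt0r_neq0.
have : w ^- 2 * b <= b.
  by rewrite ler_piMl// invf_le1 ?exprn_gt0// exprn_ege1.
have : 0 <= w ^+ 4 * (w - 1) by rewrite mulr_ge0 ?exprn_ge0//; lra.
have : 0 <= w ^+ 3 by rewrite exprn_ge0// ltW.
lra.
Qed.

Lemma Pr_pos z : Pr (fun j => (0 < j)%N%:R) z <= 1 - 2^-1 ^+ z.+1.
Proof.
have tpos : tame (fun j => (0 < j)%N%:R).
  by apply: (tame_le (tame_cst ler01)) => -[|j] /=; rewrite ?lexx ?ler01.
have := Efail_pos cookie01 0 z.+1.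
rewrite [X in (X + _)%E](PrE z tpos) -EFinD => /eqP; rewrite eqe => /eqP.
by have := fail_pmf0_ge cookie01 0 z.+1; lra.
Qed.

(** The drift of the square follows from that of the sixth power by the convexity
    inequality 3 u v^2 <= u^3 + 2 v^3. *)
Lemma Pr_shift2_far : exists z0, forall z, (z0 <= z)%N ->
  Pr (fun j => shift j ^+ 2) z <= shift z ^+ 2 - shift z / 3.
Proof.
have [z0 far] := Pr_shift6_far; exists z0 => z zz0.
have := far z zz0; have := @shift_ge1 R z; set w : R := shift z; move=> w1 hw.
have w0 : 0 < w by lra.
have c0 : 0 <= w ^- 4 / 3 by rewrite mulr_ge0 ?invr_ge0 ?exprn_ge0//; lra.
have d0 : 0 <= 2 / 3 * w ^+ 2 by rewrite mulr_ge0 ?exprn_ge0//; lra.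
have : Pr (fun j => shift j ^+ 2) z <=
    Pr (fun j => w ^- 4 / 3 * shift j ^+ 6 + 2 / 3 * w ^+ 2) z.
  apply: le_Pr; first exact: tame_shift.
    by apply: tameD; [apply: tameZ => //; exact: tame_shift|exact: tame_cst].
  move=> j; rewrite -(ler_pM2l (exprn_gt0 4 w0)) mulrDr.
  rewrite [X in _ <= X + _](_ : _ = shift j ^+ 6 / 3); last first.
    by field; rewrite lt0r_neq0.
  rewrite -subr_ge0.
  have -> : shift j ^+ 6 / 3 + w ^+ 4 * (2 / 3 * w ^+ 2) - w ^+ 4 * shift j ^+ 2 =
    (shift j ^+ 2 - w ^+ 2) ^+ 2 * (shift j ^+ 2 + 2 * w ^+ 2) / 3 by field.
  apply: divr_ge0 => //; apply: mulr_ge0; first exact: sqr_ge0.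
  by have := sqr_ge0 (shift j : R); have := sqr_ge0 w; lra.
rewrite PrD; [|by apply: tameZ => //; exact: tame_shift|exact: tame_cst].
rewrite PrZ//; last exact: tame_shift.
rewrite Pr_cst//; set A := Pr _ z; set B := Pr _ z => hA.
have : w ^- 4 / 3 * B <= w ^- 4 / 3 * (w ^+ 6 - w ^+ 5) by rewrite ler_wpM2l.
have -> : w ^- 4 / 3 * (w ^+ 6 - w ^+ 5) = (w ^+ 2 - w) / 3.
  by field; rewrite lt0r_neq0.
lra.
Qed.

(** Vanishing at 0, with a jump B between 0 and 1 that turns the probability of
    hitting 0 into a negative drift at the finitely many small states. *)
Definition lyap (B : R) (z : nat) : R :=
  if z is 0 then 0 else 3 * shift z ^+ 2 + B.

(** For large z the quadratic part suffices.  For small z > 0 the chain reaches 0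
    with probability at least 2^-(z+1), and B is chosen large accordingly. *)
Lemma exists_lyap : exists2 B, 0 <= B & forall z, (0 < z)%N ->
  Pr (lyap B) z <= lyap B z - z%:R.
Proof.
have [z0 far] := Pr_shift2_far.
have t2 : tame (fun j => shift j ^+ 2) by exact: tame_shift.
have tpos : tame (fun j => (0 < j)%N%:R).
  by apply: (tame_le (tame_cst ler01)) => -[|j] /=; rewrite ?lexx ?ler01.
have [B B0 near] := finite_bound (fun z =>
  2 ^+ z.+1 * (3 * Pr (fun j => shift j ^+ 2) z + z%:R)) z0.
exists B => // z z_gt0.
have tB : tame (fun j => 3 * shift j ^+ 2 + B * (0 < j)%N%:R).
  by apply: tameD; apply: tameZ.
have : Pr (lyap B) z <= Pr (fun j => 3 * shift j ^+ 2 + B * (0 < j)%N%:R) z.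
  apply: le_Pr => //.
    apply: tame_le tB _ => -[|j]; rewrite /= ?mulr0 ?mulr1 ?addr0 lexx ?andbT/=.
      by rewrite mulr_ge0 ?sqr_ge0.
    by rewrite addr_ge0// mulr_ge0 ?sqr_ge0.
  by move=> [|j] /=; rewrite ?mulr1 ?mulr0 ?addr0// mulr_ge0 ?sqr_ge0.
rewrite PrD; [|exact: tameZ|exact: tameZ].
rewrite !PrZ//; have := Pr_pos z.
have -> : lyap B z = 3 * shift z ^+ 2 + B by case: z z_gt0.
set E := Pr (fun j => (0 < j)%N%:R) z.
set A := Pr (fun j => shift j ^+ 2) z => hE hA.
have e0 : 0 < 2^-1 ^+ z.+1 :> R by rewrite exprn_gt0// invr_gt0.
have w2 : 0 <= shift z ^+ 2 :> R by exact: sqr_ge0.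
have BE : B * E <= B * (1 - 2^-1 ^+ z.+1) by rewrite ler_wpM2l.
have [/far|/near] := leqP z0 z.
  have : z%:R <= shift z :> R by rewrite /shift; lra.
  have : 0 <= B * 2^-1 ^+ z.+1 by rewrite mulr_ge0// ltW.
  rewrite -/A; lra.
rewrite -/A => hB.
have : 2^-1 ^+ z.+1 * (2 ^+ z.+1 * (3 * A + z%:R)) <= 2^-1 ^+ z.+1 * B.
  by rewrite ler_wpM2l// ltW.
rewrite mulrA -exprMn mulVf// expr1n mul1r; lra.
Qed.

Section potential.
Variables (B : R).
Hypotheses (B0 : 0 <= B) (BP : forall z, (0 < z)%N -> Pr (lyap B) z <= lyap B z - z%:R).
Local Notation V := (lyap B).

Lemma lyap_le z : V z <= (3 + B) * shift z ^+ 2.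
Proof.
have w2 : 1 <= shift z ^+ 2 :> R by rewrite exprn_ege1// shift_ge1.
have : B <= B * shift z ^+ 2 by rewrite ler_peMr.
by case: z w2 => [|z] w2; rewrite /lyap; have := B0; lra.
Qed.

Lemma lyap_ge z : z%:R <= V z.
Proof.
case: z => [//|z] /=; have := @shift_ge1 R z.+1.
have : z.+1%:R <= shift z.+1 :> R by rewrite /shift; lra.
move: (shift z.+1 : R) => w zw w1.
by have : 0 <= w * (w - 1) by [apply: mulr_ge0; lra]; have := B0; lra.
Qed.

Lemma tame_lyap : tame V.
Proof.
apply: (tame_le (tameZ (_ : 0 <= 3 + B) (tame_shift (isT : (2 <= 6)%N)))) => [|z].
  by rewrite addr_ge0.
by rewrite lyap_le andbT (le_trans _ (lyap_ge z)).
Qed.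

Lemma lyap_homo : {homo V : i j / (i <= j)%N >-> i <= j}.
Proof.
move=> [|i] [|j]//= ij; first by rewrite addr_ge0// mulr_ge0 ?sqr_ge0.
by rewrite lerD2r ler_pM2l// lerXn2r ?nnegrE ?shift_ge0// /shift lerD2r ler_nat.
Qed.

Lemma tame_lyap2 : tame (fun z => V z ^+ 2).
Proof.
apply: (tame_le (tameZ (_ : 0 <= (3 + B) ^+ 2) (tame_shift (isT : (4 <= 6)%N)))) => [|z].
  exact: sqr_ge0.
rewrite sqr_ge0/= -[4%N]/(2 * 2)%N exprM -exprMn lerXn2r ?nnegrE ?lyap_le//.
  by rewrite (le_trans _ (lyap_ge z)).
by rewrite mulr_ge0 ?sqr_ge0// addr_ge0.
Qed.

Lemma tame_Pr f : tame f -> tame (Pr f).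
Proof.
move=> tf; have [C fC] := tf; have [b b0 drift] := Pr_shift6.
have C0 : 0 <= C.
  have /andP[/le_trans h /h] := fC 0%N.
  by rewrite pmulr_lge0// exprn_gt0// (lt_le_trans ltr01)// shift_ge1.
exists (C * (1 + b)) => z; rewrite Pr_ge0//=.
apply: (@le_trans _ _ (Pr (fun j => C * shift j ^+ 6) z)).
  apply: le_Pr => // [|j]; first by apply: tameZ => //; exact: tame_shift.
  by have /andP[] := fC j.
rewrite PrZ//; last exact: tame_shift.
rewrite -mulrA ler_wpM2l//; apply: le_trans (drift z) _.
have : 1 <= shift z ^+ 6 :> R by rewrite exprn_ege1// shift_ge1.
have := @shiftX_ge0 R z 5; nra.
Qed.

Lemma tame_iter f n : tame f -> tame (iter n Pr f).
Proof. by move=> tf; elim: n => // n IHn; exact: tame_Pr. Qed.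

Lemma iter_homo f n : tame f -> {homo f : i j / (i <= j)%N >-> i <= j} ->
  {homo iter n Pr f : i j / (i <= j)%N >-> i <= j}.
Proof.
by move=> tf hf; elim: n => // n IHn; apply: Pr_homo => //; exact: tame_iter.
Qed.

Lemma le_Pr0 f z : tame f -> {homo f : i j / (i <= j)%N >-> i <= j} ->
  f 0%N <= Pr f z.
Proof.
move=> tf hf; rewrite -[leLHS](@Pr_cst _ z) ?(tame_ge0 _ tf)//.
apply: le_Pr => // [|j]; first by apply: tame_cst; exact: tame_ge0.
exact: hf.
Qed.

Lemma iter0_homo f : tame f -> {homo f : i j / (i <= j)%N >-> i <= j} ->
  {homo (fun n => iter n Pr f 0%N) : i j / (i <= j)%N >-> i <= j}.
Proof.
move=> tf hf; apply/nondecreasing_seqP => n /=; apply: le_Pr0.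
  exact: tame_iter.
exact: iter_homo.
Qed.

(** Summing the drift inequality bounds the sum of the first 2n means of V by a
    multiple of n; since the means increase, the n-th one is at most the average
    of the last n of them. *)
Lemma iter_lyap_bounded : exists D, forall n, iter n Pr V 0%N <= D.
Proof.
have [b b0 drift] := Pr_shift4_shift6.
pose W : nat -> R := fun j => shift j ^+ 6.
have tW : tame W by exact: tame_shift.
have tV := tame_lyap; pose C := 3 + B.
have C0 : 0 <= C by rewrite addr_ge0.
(* The drift inequality, transported by n further transitions. *)
have step z n : iter n.+1 Pr V z + C * iter n.+1 Pr W z <= C * (iter n Pr W z + b).
  elim: n z => [|n IHn] z /=.
    apply: (@le_trans _ _ (C * (Pr (fun j => shift j ^+ 4) z + Pr W z))).
      rewrite mulrDr lerD2r -PrZ//; last exact: tame_shift.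
      apply: le_Pr => // [|j]; first by apply: tameZ => //; exact: tame_shift.
      apply: le_trans (lyap_le j) _; rewrite ler_wpM2l//.
      by rewrite ler_weXn2l// shift_ge1.
    by rewrite ler_wpM2l.
  have tVn : tame (Pr (iter n Pr V)) by exact: (tame_iter n.+1).
  have tWn : tame (Pr (iter n Pr W)) by exact: (tame_iter n.+1).
  rewrite -PrZ// -PrD//; last exact: tameZ.
  rewrite -[X in _ * (_ + X)](@Pr_cst _ z)// -PrD//; last exact: tame_cst.
    rewrite -PrZ//; first apply: le_Pr => //.
    - by apply: tameD => //; exact: tameZ.
    - by apply: tameZ => //; apply: tameD; [exact: tame_iter|exact: tame_cst].
    - by apply: tameD; [exact: tame_iter|exact: tame_cst].
  exact: tame_iter.
have sum n : \sum_(i < n) iter i.+1 Pr V 0%N + C * iter n Pr W 0%N <=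
    C * (W 0%N + b * n%:R).
  elim: n => [|n IHn]; first by rewrite big_ord0 mulr0 addr0 add0r.
  rewrite big_ord_recr/= -(@natr1 _ n); have /= := step 0%N n.
  by move: (\sum_(i < n) _) IHn => S; lra.
exists (C * (W 0%N + 2 * b)) => -[|n] /=.
  rewrite mulr_ge0// addr_ge0 ?shiftX_ge0// mulr_ge0//.
have n0 : 0 < n.+1%:R :> R by [].
rewrite -(ler_pM2l n0).
apply: (@le_trans _ _ (\sum_(i < n.+1 + n.+1) iter i.+1 Pr V 0%N)).
  rewrite big_split_ord/= ler_wpDl//.
    by apply: sumr_ge0 => i _; apply: tame_ge0; exact: (tame_iter i.+1).
  rewrite mulr_natl -[n.+1 in X in X <= _]card_ord -sumr_const; apply: ler_sum => i _.
  apply: (iter0_homo tV lyap_homo (_ : n.+1 <= (n.+1 + i).+1)%N).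
  by rewrite -addnS leq_addr.
move: (sum (n.+1 + n.+1)%N); rewrite natrD; move: (\sum_(i < _) _) => S.
have : 0 <= C * iter (n.+1 + n.+1) Pr W 0%N.
  by rewrite mulr_ge0//; apply: tame_ge0; exact: tame_iter.
have : 0 <= C * W 0%N * (n.+1%:R - 1).
  by apply: mulr_ge0; rewrite ?subr_ge0 ?ler1n// mulr_ge0// shiftX_ge0.
move: (C * iter _ _ _ _) (n.+1%:R : R) => x m; lra.
Qed.

(** Expected sum of the n values of the chain that follow z. *)
Definition mean (n z : nat) : R := \sum_(i < n) iter i.+1 Pr (fun j => j%:R) z.

Definition mean1 (n z : nat) : R := z%:R + mean n z.

Lemma mean1E n z : mean1 n z = \sum_(i < n.+1) iter i Pr (fun j => j%:R) z.
Proof. by rewrite big_ord_recl. Qed.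

Lemma mean1_sum n : mean1 n = fun z => \sum_(i < n.+1) iter i Pr (fun j => j%:R) z.
Proof. by apply/funext => z; exact: mean1E. Qed.

Lemma tame_mean n : tame (mean n).
Proof.
elim: n => [|n [C HC]].
  by apply: (tame_le (tame_cst (lexx 0))) => z; rewrite /mean big_ord0 lexx.
have [D HD] := tame_iter n.+1 tame_nat.
exists (C + D) => z; rewrite /mean big_ord_recr/= mulrDl.
have /andP[c0 c1] := HC z; have /andP[d0 d1] := HD z.
by rewrite addr_ge0// lerD.
Qed.

Lemma tame_mean1 n : tame (mean1 n).
Proof. by apply: tameD (tame_mean n); exact: tame_nat. Qed.

Lemma Pr_mean1 n z : Pr (mean1 n) z = mean n.+1 z.
Proof.
rewrite mean1_sum; elim: n => [|n IHn].
  rewrite /mean big_ord1; apply: eq_Pr => j; exact: big_ord1.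
rewrite /mean big_ord_recr/= -/(mean n.+1 z) -IHn -PrD.
- by apply: eq_Pr => j; rewrite big_ord_recr.
- by rewrite -mean1_sum; exact: tame_mean1.
- by apply: (tame_iter n.+1); exact: tame_nat.
Qed.

Lemma mean1_homo n : {homo mean1 n : i j / (i <= j)%N >-> i <= j}.
Proof.
move=> i j ij; rewrite !mean1E; apply: ler_sum => k _.
by apply: iter_homo ij; [exact: tame_nat|move=> a b ab; rewrite ler_nat].
Qed.

(** The excess over the start at 0 satisfies the recursion of which V is a
    supersolution. *)
Lemma mean1_le n z : mean1 n z <= mean1 n 0%N + V z.
Proof.
elim: n z => [|n IHn] z.
  by rewrite /mean1 /mean !big_ord0 !addr0 add0r lyap_ge.
case: z => [|z]; first by rewrite addr0.
rewrite {1}/mean1 -Pr_mean1.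
apply: (@le_trans _ _ (z.+1%:R + (mean1 n 0%N + Pr V z.+1))).
  rewrite lerD2l -[X in _ <= X + _](@Pr_cst _ z.+1); last first.
    by apply: tame_ge0; exact: tame_mean1.
  rewrite -PrD//; [|apply: tame_cst|exact: tame_lyap]; last first.
    by apply: tame_ge0; exact: tame_mean1.
  apply: le_Pr => //; first exact: tame_mean1.
  apply: tameD; last exact: tame_lyap.
  by apply: tame_cst; apply: tame_ge0; exact: tame_mean1.
have : mean1 n 0%N <= mean1 n.+1 0%N.
  rewrite !mean1E [leRHS]big_ord_recr/= lerDl.
  by apply: tame_ge0; apply: (tame_iter n.+1); exact: tame_nat.
have := BP (isT : (0 < z.+1)%N); lra.
Qed.

Lemma mean_cvg : exists2 e : R, 0 <= e & (fun n => mean n 0%N / n%:R) @ \oo --> e.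
Proof.
have [D HD] := iter_lyap_bounded.
pose u n : R := iter n.+1 Pr (fun j => j%:R) 0%N.
have u0 n : 0 <= u n by exact: (tame_ge0 0%N (tame_iter n.+1 tame_nat)).
have nat_homo : {homo (fun j : nat => j%:R : R) : i j / (i <= j)%N >-> i <= j}.
  by move=> a b ab; rewrite ler_nat.
have uD n : u n <= D.
  apply: le_trans (HD n.+1); rewrite /u; elim: n.+1 0%N => [|k IHk] z //=.
    exact: lyap_ge.
  apply: le_Pr; [exact: tame_iter tame_nat|exact: tame_iter tame_lyap|exact: IHk].
have ucvg : cvgn u.
  apply: nondecreasing_is_cvgn.
    by move=> i j ij; apply: (iter0_homo tame_nat nat_homo); rewrite ltnS.
  by exists D => _ [n _ <-].
exists (limn u); first by apply: limr_ge => //; exact: nearW.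
rewrite -cvg_shiftS; apply: cvg_trans (cesaro ucvg).
apply: near_eq_cvg; apply: nearW => n; rewrite /arithmetic_mean /=.
by rewrite /series/= big_mkord mulrC.
Qed.

(** The variance of Y under the transition is at most the second moment of
    Y - y0, which V dominates.  Negative terms are moved to the other side
    because the operator is additive on non-negative functions. *)
Lemma Pr_sqr (Y : nat -> R) (y0 beta : R) z : tame Y ->
  (forall j, 0 <= Y j - y0 <= V j) ->
  Pr (fun j => (Y j + beta) ^+ 2) z <=
  (Pr Y z + beta) ^+ 2 + Pr (fun j => V j ^+ 2) z.
Proof.
move=> tY YV; pose U j := Y j - y0; pose g := y0 + beta.
have tU : tame U by exact: tame_le tame_lyap YV.
have tU2 : tame (fun j => U j ^+ 2).
  apply: tame_le tame_lyap2 _ => j; rewrite sqr_ge0/=; have /andP[h1 h2] := YV j.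
  by rewrite lerXn2r ?nnegrE// (le_trans h1).
have PY : Pr Y z = Pr U z + y0.
  have [y00|y00] := leP 0 y0.
    rewrite -[X in _ = _ + X](@Pr_cst _ z)// -PrD//; last exact: tame_cst.
    by apply: eq_Pr => j; rewrite /U subrK.
  apply/eqP; rewrite -subr_eq; apply/eqP.
  have y01 : 0 <= - y0 by lra.
  by rewrite -[X in _ + X](@Pr_cst _ z)// -PrD//; exact: tame_cst.
have gp : 0 <= 2 * Num.max g 0 by rewrite mulr_ge0// le_max lexx orbT.
have gn : 0 <= 2 * Num.max (- g) 0 by rewrite mulr_ge0// le_max lexx orbT.
(* g may be negative; its positive and negative parts appear on opposite sides
   of the identity E below. *)
have gE : g = Num.max g 0 - Num.max (- g) 0 by rewrite /Num.max; do 2 case: ifP; lra.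
have g2 : 0 <= g ^+ 2 by exact: sqr_ge0.
have tg : tame (fun j => U j ^+ 2 + (2 * Num.max g 0 * U j + g ^+ 2)).
  by apply: tameD => //; apply: tameD; [exact: tameZ|exact: tame_cst].
have E j : (Y j + beta) ^+ 2 + 2 * Num.max (- g) 0 * U j =
    U j ^+ 2 + (2 * Num.max g 0 * U j + g ^+ 2).
  have -> : Y j + beta = U j + g by rewrite /U /g; lra.
  move: gE; set a := Num.max g 0; set b := Num.max (-g) 0 => gE.
  by rewrite gE; ring.
have tY2 : tame (fun j => (Y j + beta) ^+ 2).
  apply: tame_le tg _ => j; rewrite sqr_ge0/= -E lerDl mulr_ge0//.
  exact: tame_ge0.
have := PrD z tY2 (tameZ gn tU).
rewrite (eq_Pr _ E) PrD//; last by apply: tameD; [exact: tameZ|exact: tame_cst].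
rewrite PrD//; [|exact: tameZ|exact: tame_cst].
rewrite Pr_cst// !PrZ// => EQ.
have : Pr (fun j => U j ^+ 2) z <= Pr (fun j => V j ^+ 2) z.
  apply: le_Pr => //; first exact: tame_lyap2.
  move=> j; have /andP[h1 h2] := YV j; by rewrite lerXn2r ?nnegrE// (le_trans h1).
have : 0 <= Pr U z ^+ 2 by exact: sqr_ge0.
move: EQ; rewrite PY; set x := Pr _ z; set y := Pr U z; set v := Pr _ z.
move: gE g2; set a := Num.max g 0; set b := Num.max (-g) 0 => gE g2.
have -> : (y + y0 + beta) ^+ 2 = y ^+ 2 + 2 * g * y + g ^+ 2 by rewrite /g; ring.
have -> : 2 * g * y = 2 * a * y - 2 * b * y by rewrite {1}gE; ring.
lra.
Qed.

End potential.
End chain.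

(** * Left jumps of the walk, site by site *)

Section sites.
Context {R : realType} (q : nat -> R).
Hypothesis q01 : forall c, 1 / 2 <= q c <= 1.
Let q0 c : 0 <= q c. Proof. by have := q01 c; lra. Qed.
Let q1 c : 0 <= 1 - q c. Proof. by have := q01 c; lra. Qed.

(** Expectation of G (s + sum_k w k D_k) over the left jumps D_k that are still
    to be made from the m sites k, k - 1, ..., when d left jumps are still to be
    made from k + 1.  The walk is at x and has visited each site k' already
    [c k'] times (the present visit excluded).  A site at or to the right of x
    must be left to the right once more than it will be entered from the right,
    hence the boolean added to d. *)
Fixpoint Esites (w : int -> nat) (G : nat -> R) (x : int) (c : int -> nat)
    (m : nat) (k : int) (d s : nat) : \bar R :=
  if m is m'.+1 then
    Efail q (c k) (d + (x <= k)%R)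
      (fun j => Esites w G x c m' (k - 1) j (s + w k * j))
  else (G s)%:E.

Definition bump (c : int -> nat) (x k : int) : nat := (c k + (k == x))%N.

Context (w : int -> nat) (G : nat -> R).
Hypothesis G0 : forall s, 0 <= G s.

Local Notation Es := (Esites w G).
Local Open Scope ereal_scope.

Lemma Esites_ge0 x c m k d s : 0 <= Es x c m k d s.
Proof.
elim: m k d s => [|m IHm] k d s /=; first by rewrite lee_fin.
exact: Efail_ge0.
Qed.

Lemma eq_Esites x1 x2 c1 c2 m k d s :
    (forall k', (k' <= k)%R -> c1 k' = c2 k') ->
    (forall k', (k' <= k)%R -> (x1 <= k')%R = (x2 <= k')%R) ->
  Es x1 c1 m k d s = Es x2 c2 m k d s.
Proof.
elim: m k d s => //= m IHm k d s c12 x12.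
rewrite c12// x12//; apply: eq_Efail => j; apply: IHm => k' k'k.
  by apply: c12; lia.
by apply: x12; lia.
Qed.

(** Only the sites x and x - 1 are affected by a jump from x.  After a right jump
    x needs one success less.  After a left jump x has one failure more, counted
    in s, and x - 1 one success more to wait for; the latter agrees with the
    expectation before the jump, where the left jump from x was part of D_x. *)
Lemma Esites_step x c m k d s : (x <= k)%R -> (k < x - 1 + m%:Z)%R ->
  Es x c m k d s = (q (c x))%:E * Es (x + 1) (bump c x) m k d s +
    (1 - q (c x))%:E * Es (x - 1) (bump c x) m k d (s + w x).
Proof.
elim: m k d s => [|m IHm] k d s xk km; first by lia.
have [kx|kx] := eqVneq k x; last first.
  rewrite /= /bump (negbTE kx) addn0.
  have -> : (x <= k)%R by [].
  have -> : (x + 1 <= k)%R by lia.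
  have -> : (x - 1 <= k)%R by lia.
  rewrite -!EfailZ// => [|j|j]; try exact: Esites_ge0.
  rewrite -EfailD// => [|j|j]; try by rewrite mule_ge0 ?lee_fin ?Esites_ge0.
  apply: eq_Efail => j; rewrite IHm; [|lia|lia].
  by rewrite addnAC.
subst k; case: m IHm km => [|m] _ km; first by lia.
rewrite [LHS]/=; rewrite lexx; rewrite addn1.
rewrite [LHS]EfailS; last 2 first.
- by [].
- by move=> j; apply: Efail_ge0 => // i; exact: Esites_ge0.
rewrite /= /bump eqxx addn1.
have -> : (x + 1 <= x)%R = false by lia.
have -> : (x - 1 <= x)%R by lia.
have -> : (x + 1 <= x - 1)%R = false by lia.
have -> : (x <= x - 1)%R = false by lia.
have -> : (x - 1 <= x - 1)%R by [].
have -> : (x - 1 == x)%R = false by lia.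
rewrite !addn0; rewrite !addn1.
apply: (f_equal2 (fun a b => _ * a + _ * b)); apply: eq_Efail => j.
  rewrite !addn0; apply: eq_Efail => i; apply: eq_Esites => k' k'k.
    by rewrite (_ : (k' == x) = false) ?addn0//; lia.
  by lia.
rewrite /= addn0 addn1; apply: eq_Efail => i; rewrite mulnS addnA.
apply: eq_Esites => k' k'k.
  by rewrite (_ : (k' == x) = false) ?addn0//; lia.
by lia.
Qed.

Lemma Esites_done x c m k s : (k < x)%R -> Es x c m k 0 s = (G s)%:E.
Proof.
elim: m k s => //= m IHm k s kx.
rewrite (_ : (x <= k)%R = false) ?addn0; last by lia.
rewrite Efail0 => [|//|j]; last exact: Esites_ge0.
by rewrite muln0 addn0 IHm//; lia.
Qed.

Lemma Esites_ge x c m k d s : {homo G : i j / (i <= j)%N >-> (i <= j)%R} ->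
  (G s)%:E <= Es x c m k d s.
Proof.
move=> hG; elim: m k d s => //= m IHm k d s.
rewrite -[leLHS](@Efail_cst _ q _ (c k) (d + (x <= k)%R))//.
apply: le_Efail => // j; first by rewrite lee_fin.
by apply: le_trans (IHm _ _ _); rewrite lee_fin; apply: hG; exact: leq_addr.
Qed.

Lemma Esites_weightless x c m k d s : (forall k', (k' <= k)%R -> w k' = 0%N) ->
  Es x c m k d s = (G s)%:E.
Proof.
elim: m k d s => //= m IHm k d s w0.
rewrite -[RHS](@Efail_cst _ q _ (c k) (d + (x <= k)%R))//.
apply: eq_Efail => j; rewrite w0// mul0n addn0; apply: IHm => k' k'k.
by apply: w0; lia.
Qed.

End sites.

Section fresh.
Context {R : realType} (M : nat) (p : R).
Hypothesis p01 : 1 / 2 <= p <= 1.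
Hypothesis drift10 : 10 <= M%:R * (2 * p - 1).
Local Notation cookie := (cookie M p).
Local Notation Pr := (Pr M p).
Let cookie01 : forall c, 1 / 2 <= cookie c <= 1 := cookie01 M p01.
#[local] Hint Resolve cookie01 : core.

Definition fresh (w : int -> nat) (G : nat -> R) := Esites cookie w G 0 (fun=> 0%N).

Lemma freshS w G m (k : int) d s : 0 <= k ->
  fresh w G m.+1 k d s =
  Efail cookie 0 d.+1 (fun j => fresh w G m (k - 1) j (s + w k * j)).
Proof. by move=> k0; rewrite /fresh /= k0 addn1. Qed.

(** Sites 0, ..., n - 1 have an immigrant, so an upper bound propagates from site
    -1 up to site n - 1 by the transition operator. *)
Lemma fresh_le w G m (F : nat -> nat -> nat -> R) :
    (forall s, 0 <= G s) ->
    (forall d s, (fresh w G m (-1) d s <= (F 0%N d s)%:E)%E) ->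
    (forall n s, exists f, [/\ tame f,
      forall j, F n j (s + w n%:Z * j)%N <= f j &
      forall d, Pr f d <= F n.+1 d s]) ->
  forall n d s, (fresh w G (n + m) (n%:Z - 1)%R d s <= (F n d s)%:E)%E.
Proof.
move=> G0 base step; elim=> [|n IHn] d s; first exact: base.
rewrite addSn (_ : n.+1%:Z - 1 = n%:Z); last by lia.
have [f [tf Ff fF]] := step n s.
rewrite freshS//; apply: (@le_trans _ _ (Efail cookie 0 d.+1 (EFin \o f))).
  apply: le_Efail => // j; first by apply: Esites_ge0.
  by apply: le_trans (IHn _ _) _; rewrite lee_fin.
by rewrite PrE// lee_fin.
Qed.

(** On the negative sites there is no immigrant: from z one waits for z successes
    only, 0 is absorbing, and V still is a Lyapunov function by monotonicity. *)
Lemma fresh_negative (B : R) w m (k : int) d s : 0 <= B ->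
    (forall z, (0 < z)%N -> Pr (lyap B) z <= lyap B z - z%:R) ->
    (forall k : int, k < 0 -> w k = 1%N) -> k < 0 ->
  (fresh w (fun s => s%:R) m k d s <= (s%:R + (lyap B d - d%:R))%:E)%E.
Proof.
move=> B0 BP w1; elim: m k d s => [|m IHm] k d s k0.
  by rewrite lee_fin lerDl subr_ge0 lyap_ge.
rewrite /fresh /= (_ : (0 <= k) = false) ?addn0 ?w1//; last by lia.
have tV : tame (fun j => s%:R + lyap B j).
  by apply: tameD; [exact: tame_cst|exact: tame_lyap].
have hV : {homo (fun j => s%:R + lyap B j : R) : i j / (i <= j)%N >-> i <= j}.
  by move=> i j ij; rewrite lerD2l lyap_homo.
apply: (@le_trans _ _ (Efail cookie 0 d (EFin \o (fun j => s%:R + lyap B j)))).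
  apply: le_Efail => // j; first by apply: Esites_ge0.
  apply: le_trans (IHm _ _ _ _) _; first lia.
  by rewrite mul1n natrD lee_fin; lra.
case: d => [|d].
  rewrite Efail0//; first by rewrite /= subr0.
  by move=> j; rewrite lee_fin; exact: (tame_ge0 j tV).
have := Efail_leS cookie01 0 d.+1 (fun j => tame_ge0 j tV) hV.
move=> /le_trans; apply.
rewrite PrE// lee_fin PrD//; [|exact: tame_cst|exact: tame_lyap].
by rewrite Pr_cst// lerD2l BP.
Qed.

(** Variance of the left jumps from sites >= 0, mean of those from sites < 0, and
    a crude bound on the mean of all of them, uniformly in the number m of
    negative sites. *)
Lemma fresh_bounds : exists (mu : nat -> R) (e K : R),
  [/\ 0 <= e, (fun n => mu n / n%:R) @ \oo --> e &
  forall n m,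
  [/\ (fresh (fun k => (0 <= k)%R : nat) (fun s => ((s%:R - mu n) ^+ 2)%R)
         (n + m) (n%:Z - 1)%R 0 0 <= (K * n.+1%:R)%R%:E)%E,
      (fresh (fun k => (k < 0)%R : nat) (fun s => s%:R%R)
         (n + m) (n%:Z - 1)%R 0 0 <= K%:E)%E &
      (fresh (fun=> 1%N) (fun s => s%:R%R) (n + m) (n%:Z - 1)%R 0 0
         <= (K * n.+1%:R)%R%:E)%E]].
Proof.
have [B B0 BP] := exists_lyap p01 drift10.
have [e e0 mean_e] := mean_cvg p01 drift10 B0.
have [D HD] := iter_lyap_bounded p01 drift10 B0.
have [b b0 Hb] := Pr_shift4_shift6 p01 drift10.
pose K := (3 + B) ^+ 2.
have K0 : 0 <= K by exact: sqr_ge0.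
have tV := tame_lyap B0.
pose W z : R := shift z ^+ 6.
have tW : tame W by exact: tame_shift.
have VK4 z : lyap B z ^+ 2 <= K * shift z ^+ 4.
  rewrite -[4%N]/(2 * 2)%N exprM -exprMn lerXn2r ?nnegrE ?lyap_le//.
    by rewrite (le_trans _ (lyap_ge B0 z)).
  by rewrite mulr_ge0 ?sqr_ge0// addr_ge0.
have K3 : 3 + B <= K by rewrite /K expr2 ler_peMr//; lra.
have VK k z : (2 <= k)%N -> lyap B z <= K * shift z ^+ k.
  move=> k2; apply: le_trans (lyap_le B0 z) _.
  rewrite ler_pM ?sqr_ge0//; first lra.
  by rewrite ler_weXn2l// shift_ge1.
(* One step of the induction on n: what the function f costs in one transition
   is paid for by the drift of W. *)
have absorb f n z : tame f -> (forall j, f j <= K * shift j ^+ 4) ->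
    Pr f z + Pr (fun j => K * (W j + b * n%:R)) z <= K * (W z + b * n.+1%:R).
  move=> tf fK.
  rewrite PrZ//; last by apply: tameD => //; apply: tame_cst; exact: mulr_ge0.
  rewrite PrD//; last by apply: tame_cst; exact: mulr_ge0.
  rewrite Pr_cst//; last exact: mulr_ge0.
  have : Pr f z <= K * Pr (fun j => shift j ^+ 4) z.
    rewrite -PrZ//; last exact: tame_shift.
    by apply: le_Pr => //; apply: tameZ => //; exact: tame_shift.
  have : K * (Pr (fun j => shift j ^+ 4) z + Pr W z) <= K * (W z + b).
    by rewrite ler_wpM2l.
  by rewrite -(@natr1 _ n); lra.
have tWb n : tame (fun j => K * (W j + b * n%:R)).
  by apply: tameZ => //; apply: tameD => //; apply: tame_cst; exact: mulr_ge0.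
exists (fun n => mean M p n 0), e, (D + K * (W 0%N + b)); split => // n m.
have n1 : 1 <= n.+1%:R :> R by rewrite ler1n.
have D0 : 0 <= D.
  by apply: le_trans (HD 0%N).
have KW0 : 0 <= K * W 0%N by rewrite mulr_ge0// shiftX_ge0.
have Kb0 : 0 <= K * b by rewrite mulr_ge0.
have KWn : K * (W 0%N + b * n%:R) <= (D + K * (W 0%N + b)) * n.+1%:R.
  rewrite -(@natr1 _ n) in n1 *.
  have : 0 <= D * (n%:R + 1) by rewrite mulr_ge0//; lra.
  have : 0 <= K * W 0%N * n%:R by rewrite mulr_ge0.
  lra.
split.
- set a := mean M p n 0.
  apply: (@le_trans _ _ ((mean M p n 0 + (0%N%:R - a)) ^+ 2 +
      K * (W 0%N + b * n%:R))%:E); last first.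
    by rewrite lee_fin /a sub0r subrr expr0n/= add0r.
  apply: (@fresh_le _ _ _ (fun k d s =>
    (mean M p k d + (s%:R - a)) ^+ 2 + K * (W d + b * k%:R))).
  + by move=> s; exact: sqr_ge0.
  + move=> d s; rewrite /fresh Esites_weightless//=.
    * by rewrite /mean big_ord0 add0r mulr0 addr0 lee_fin lerDl mulr_ge0 ?shiftX_ge0.
    * by move=> s'; exact: sqr_ge0.
    * by move=> k k0 /=; rewrite leNgt (le_lt_trans k0).
  move=> k s; set c := s%:R - a.
  have tm : tame (fun j => (mean1 M p k j + c) ^+ 2).
    have t0 : tame (fun j => 4 * lyap B j ^+ 2 + (4 * mean1 M p k 0 ^+ 2 + 2 * c ^+ 2)).
      apply: tameD; first by apply: tameZ => //; exact: tame_lyap2.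
      by apply: tame_cst; rewrite addr_ge0// mulr_ge0 ?sqr_ge0.
    apply: tame_le t0 _ => j; rewrite sqr_ge0/=.
    have : 0 <= mean1 M p k j by apply: tame_ge0; exact: tame_mean1.
    have := mean1_le p01 drift10 B0 BP k j.
    move: (mean1 M p k j) (mean1 M p k 0) (lyap B j) => x y v xyv x0.
    have : x ^+ 2 <= (y + v) ^+ 2 by rewrite lerXn2r ?nnegrE// (le_trans x0).
    have := sqr_ge0 (x - c); have := sqr_ge0 (y - v); lra.
  exists (fun j => (mean1 M p k j + c) ^+ 2 + K * (W j + b * k%:R)); split.
  + exact: tameD.
  + by move=> j; rewrite /= mul1n natrD /mean1 /c; set u := K * _; lra.
  + move=> d; rewrite PrD//.
    have : Pr (fun j => (mean1 M p k j + c) ^+ 2) d <=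
        (mean M p k.+1 d + c) ^+ 2 + Pr (fun j => lyap B j ^+ 2) d.
      rewrite -Pr_mean1//; apply: (Pr_sqr M p01 B0 (y0 := mean1 M p k 0)).
        exact: tame_mean1.
      move=> j; rewrite subr_ge0 mean1_homo//=.
      by have := mean1_le p01 drift10 B0 BP k j; lra.
    by have := absorb _ k d (tame_lyap2 B0) VK4; lra.
- apply: (@le_trans _ _ (0%N%:R + iter n Pr (lyap B) 0)%:E); last first.
    have : 0 <= K * W 0%N + K * b by exact: addr_ge0.
    by rewrite lee_fin; have := HD n; rewrite mulr0n; lra.
  apply: (@fresh_le _ _ _ (fun k d s => s%:R + iter k Pr (lyap B) d)) => //.
  + move=> d s; apply: le_trans (fresh_negative _ _ _ B0 BP _ _) _ => //.
      by move=> k ->.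
    by rewrite lee_fin lerD2l/= gerBl.
  move=> k s; exists (fun j => s%:R + iter k Pr (lyap B) j).
  have ti : tame (iter k Pr (lyap B)) by exact: tame_iter.
  split; first by apply: tameD => //; exact: tame_cst.
  + by move=> j; rewrite /= addn0.
  + by move=> d; rewrite PrD//; [rewrite Pr_cst|exact: tame_cst].
- apply: (@le_trans _ _ (0%N%:R + K * (W 0%N + b * n%:R))%:E); last first.
    by rewrite lee_fin mulr0n add0r.
  apply: (@fresh_le _ _ _ (fun k d s => s%:R + K * (W d + b * k%:R))) => //.
  + move=> d s; apply: le_trans (fresh_negative _ _ _ B0 BP _ _) _ => //.
    rewrite lee_fin lerD2l/= mulr0 addr0; have := VK 6%N d isT.
    by have : 0 <= d%:R :> R by []; rewrite /W; lra.
  move=> k s; exists (fun j => s%:R + (j%:R + K * (W j + b * k%:R))).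
  have tn : tame (fun j => j%:R + K * (W j + b * k%:R)).
    by apply: tameD => //; exact: tame_nat.
  split; first by apply: tameD => //; exact: tame_cst.
  + by move=> j; rewrite mul1n natrD addrA.
  + move=> d; rewrite PrD//; last exact: tame_cst.
    rewrite Pr_cst// lerD2l PrD//; last exact: tame_nat.
    apply: absorb; first exact: tame_nat.
    by move=> j; apply: le_trans (lyap_ge B0 j) _; exact: VK.
Qed.

End fresh.

(** * From the chain to the walk *)

Section paths.
Implicit Types (y : nat -> int) (w : int -> nat) (n : int).

Definition passes y t (k : int) : nat := (\sum_(i < t) (y i == k))%N.

Definition lefts w y t : nat :=
  (\sum_(i < t) (y i.+1 == y i - 1)%R * w (y i))%N.

Definition upd y t (v : int) : nat -> int := fun i => if (i <= t)%N then y i else v.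

Definition below n y t : Prop :=
  y 0%N = 0 /\ forall i, (i < t)%N ->
    (y i.+1 = y i + 1 \/ y i.+1 = y i - 1) /\ y i < n.

Lemma visits_passes y t : visits y t = (passes y t (y t)).+1.
Proof.
rewrite /visits /passes mkseqS -cats1 count_cat /= eqxx addn0 addn1.
congr _.+1; move: (y t) => v; elim: t => [|t IHt]; first by rewrite big_ord0.
by rewrite mkseqS -cats1 count_cat /= addn0 IHt big_ord_recr/=.
Qed.

Lemma upd_le y t v i : (i <= t)%N -> upd y t v i = y i.
Proof. by rewrite /upd => ->. Qed.

Lemma updS y t v : upd y t v t.+1 = v.
Proof. by rewrite /upd ltnn. Qed.

Lemma passes_upd y t v : passes (upd y t v) t.+1 = bump (passes y t) (y t).
Proof.
apply/funext => k; rewrite /passes big_ord_recr/= upd_le// /bump eq_sym.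
congr (_ + _)%N; apply: eq_bigr => i _.
by rewrite upd_le// ltnW.
Qed.

Lemma lefts_upd w y t v :
  lefts w (upd y t v) t.+1 = (lefts w y t + (v == y t - 1)%R * w (y t))%N.
Proof.
rewrite /lefts big_ord_recr/= updS upd_le//; congr (_ + _)%N.
by apply: eq_bigr => i _; rewrite !upd_le// ltnW.
Qed.

Lemma below_upd n y t v : below n y t -> y t < n ->
  v = y t + 1 \/ v = y t - 1 -> below n (upd y t v) t.+1.
Proof.
move=> [y0 yS] ytn vE; split; first by rewrite upd_le.
move=> i; rewrite ltnS leq_eqVlt => /orP[/eqP->|it].
  by rewrite updS upd_le.
by rewrite !upd_le ?(ltnW it)//; exact: yS.
Qed.

Lemma below_ge n y t : below n y t -> - t%:Z <= y t.
Proof.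
elim: t => [[-> _]//|t IHt [y0 yS]].
have [] := yS t (ltnSn t); have : - t%:Z <= y t; last by lia.
by apply: IHt; split=> // i it; apply: yS; exact: ltnW.
Qed.

(** The time is the number of right jumps plus the number of left jumps, and the
    position is their difference. *)
Lemma below_time n y t : below n y t -> t%:Z = y t + (2 * lefts (fun=> 1%N) y t)%N%:Z.
Proof.
elim: t => [[-> _]|t IHt [y0 yS]]; first by rewrite /lefts big_ord0.
rewrite /lefts big_ord_recr/= -/(lefts (fun=> 1%N) y t).
have : t%:Z = y t + (2 * lefts (fun=> 1%N) y t)%N%:Z.
  by apply: IHt; split=> // i it; apply: yS; exact: ltnW.
have [[->|->] _] := yS t (ltnSn t).
  by rewrite (_ : (_ == _) = false); lia.
by rewrite eqxx; lia.
Qed.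

Lemma lefts_split y t :
  lefts (fun=> 1%N) y t =
  (lefts (fun k => (0 <= k)%R) y t + lefts (fun k => (k < 0)%R) y t)%N.
Proof.
rewrite /lefts -big_split/=; apply: eq_bigr => i _.
by rewrite -mulnDr ltNge; case: (0 <= y i).
Qed.

End paths.

Section erw.
Context d (T : measurableType d) {R : realType} (P : probability T R).
Context (X : nat -> T -> int) (q : nat -> R).
Hypothesis q01 : forall c, 1 / 2 <= q c <= 1.
Context (omega : cookie_env R).
Hypothesis omegaE : forall x c, omega x c.+1 = q c.
Hypothesis erw : excited_random_walk P 0 omega X.
Local Open Scope ereal_scope.

Definition misses (n : int) (ok : pred nat) (N : nat) : set T :=
  [set s | forall t, (t <= N)%N -> ok t -> X t s <> n].

Lemma measurable_at t z : measurable [set s | X t s = z].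
Proof. exact: (erw_measurable erw t z). Qed.

Lemma measurable_past t y : measurable (past X t y).
Proof.
have -> : past X t y = \bigcap_(k in [set k | (k <= t)%N]) [set s | X k s = y k].
  by apply/seteqP; split => s h k; exact: h.
by apply: bigcap_measurableType => // k _; exact: measurable_at.
Qed.

Lemma measurable_misses n ok N : measurable (misses n ok N).
Proof.
have -> : misses n ok N =
    \bigcap_(k in [set k | (k <= N)%N /\ ok k]) ~` [set s | X k s = n].
  apply/seteqP; split => s h k; first by move=> [kN okk]; exact: h.
  by move=> kN okk; exact: h.
by apply: bigcap_measurableType => // k _; apply: measurableC; exact: measurable_at.
Qed.

Lemma past_upd t y v :
  past X t y `&` [set s | X t.+1 s = v] = past X t.+1 (upd y t v).
Proof.
apply/seteqP; split => s.
  move=> [ys vs] k; rewrite leq_eqVlt => /orP[/eqP->|kt]; first by rewrite updS.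
  by rewrite upd_le//; exact: ys.
move=> ys; split=> [k kt|]; last by rewrite /= ys// updS.
by rewrite ys ?upd_le//; exact: leqW.
Qed.

Lemma past_right t y : P (past X t.+1 (upd y t (y t + 1)%R)) =
  (q (passes y t (y t)))%:E * P (past X t y).
Proof. by rewrite -past_upd (erw_right erw) visits_passes omegaE. Qed.

Lemma past_left t y : P (past X t.+1 (upd y t (y t - 1)%R)) =
  (1 - q (passes y t (y t)))%:E * P (past X t y).
Proof. by rewrite -past_upd (erw_left erw) visits_passes omegaE. Qed.

(** An atom of the past splits into its two continuations, up to a null set. *)
Lemma past_split (E : set T) t y : measurable E ->
  P (E `&` past X t y) <=
  P (E `&` past X t.+1 (upd y t (y t + 1)%R)) +
  P (E `&` past X t.+1 (upd y t (y t - 1)%R)).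
Proof.
move=> mE; set A := past X t y.
set A1 := past X t.+1 _; set A2 := past X t.+1 _.
have mA : measurable A by exact: measurable_past.
have mA1 : measurable A1 by exact: measurable_past.
have mA2 : measurable A2 by exact: measurable_past.
have A1A : A1 `<=` A by rewrite /A1 -past_upd; exact: subIsetl.
have A2A : A2 `<=` A by rewrite /A2 -past_upd; exact: subIsetl.
have disj : A1 `&` A2 = set0.
  apply/seteqP; split=> // s [s1 s2].
  have := s1 t.+1 (leqnn _); rewrite (s2 t.+1 (leqnn _)) !updS => h.
  by exfalso; move: h; lia.
have PA : P A = P A1 + P A2.
  rewrite past_right past_left -ge0_muleDl ?lee_fin.
  - by rewrite -EFinD addrC subrK mul1e.
  - by have := q01 (passes y t (y t)); lra.
  - by have := q01 (passes y t (y t)); lra.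
have null : P (A `\` (A1 `|` A2)) = 0.
  have finP B : measurable B -> P B \is a fin_num by move=> mB; exact: fin_num_measure.
  rewrite measureD//; [|exact: measurableU|by rewrite -ge0_fin_numE// finP].
  rewrite (setIidr _); last by move=> s [/A1A|/A2A].
  by rewrite measureU// [X in (X - _)%E]PA subee// fin_numD !finP.
apply: (@le_trans _ _ (P ((E `&` A1) `|` (E `&` A2) `|` (A `\` (A1 `|` A2))))).
  apply: le_measure; rewrite ?inE.
  - exact: measurableI.
  - by apply: measurableU; [apply: measurableU; exact: measurableI|
      apply: measurableD => //; exact: measurableU].
  - move=> s [Es As]; have [s12|s12] := pselect ((A1 `|` A2) s); last by right.
    by left; case: s12 => ?; [left|right].
apply: le_trans (measureU2 _ _ _) _.
- by apply: measurableU; exact: measurableI.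
- by apply: measurableD => //; exact: measurableU.
rewrite [X in (_ + X <= _)%E]null adde0; apply: measureU2; exact: measurableI.
Qed.

(** A supersolution U bounds the probability of [misses] on each atom of the past,
    by induction on the number of steps that remain before N.  The induction
    stops when n is reached: either the time is admissible and the event is
    empty, or U is at least 1. *)
Lemma misses_le (n : int) ok N (U : (nat -> int) -> nat -> \bar R) :
    (0 < n)%R -> (forall y t, 0 <= U y t) ->
    (forall y t, below n y t -> y t = n -> ~~ ok t -> 1 <= U y t) ->
    (forall y, below n y N -> (y N < n)%R -> 1 <= U y N) ->
    (forall y t, below n y t -> (y t < n)%R -> (t < N)%N ->
      (q (passes y t (y t)))%:E * U (upd y t (y t + 1)%R) t.+1 +
      (1 - q (passes y t (y t)))%:E * U (upd y t (y t - 1)%R) t.+1 <= U y t) ->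
  P (misses n ok N) <= U (fun=> 0%R) 0%N.
Proof.
move=> n0 U0 U1 U2 U3.
have mE : measurable (misses n ok N) by exact: measurable_misses.
have PI y t : P (misses n ok N `&` past X t y) <= P (past X t y).
  by apply: le_measure; rewrite ?inE//; [apply: measurableI => //|];
    exact: measurable_past.
have main m t y : (t + m)%N = N -> below n y t -> (y t <= n)%R ->
    P (misses n ok N `&` past X t y) <= U y t * P (past X t y).
  elim: m t y => [|m IHm] t y tmN yt; rewrite le_eqVlt => /orP[/eqP ytn|ytn].
  - have [okt|/(U1 _ _ yt ytn) U1t] := boolP (ok t).
      rewrite (_ : _ `&` _ = set0) ?measure0 ?mule_ge0//.
      apply/seteqP; split => // s [sE sy]; apply: (sE t) => //; first lia.
      by rewrite sy.
    by apply: le_trans (PI _ _) _; rewrite -[leLHS]mul1e lee_wpmul2r.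
  - apply: le_trans (PI _ _) _; rewrite -[leLHS]mul1e lee_wpmul2r//.
    by move: tmN yt ytn; rewrite addn0 => ->; exact: U2.
  - have [okt|/(U1 _ _ yt ytn) U1t] := boolP (ok t).
      rewrite (_ : _ `&` _ = set0) ?measure0 ?mule_ge0//.
      apply/seteqP; split => // s [sE sy]; apply: (sE t) => //; first lia.
      by rewrite sy.
    by apply: le_trans (PI _ _) _; rewrite -[leLHS]mul1e lee_wpmul2r.
  - apply: le_trans (past_split _ _ mE) _.
    have tN : (t < N)%N by lia.
    apply: le_trans (lee_wpmul2r _ (U3 y t yt ytn tN)); last by [].
    have /andP[q0 q1] := q01 (passes y t (y t)).
    rewrite ge0_muleDl; last 2 first.
    + by rewrite mule_ge0 ?lee_fin//; lra.
    + by rewrite mule_ge0 ?lee_fin//; lra.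
    rewrite -!muleA ![in leRHS](muleCA _%:E) -past_right -past_left.
    by apply: leeD; apply: IHm; rewrite ?updS; try lia; apply: below_upd => //;
      [left|right].
have P1 : P (past X 0 (fun=> 0%R)) = 1.
  rewrite -(erw_start erw); congr (P _); apply/seteqP; split => s; first exact.
  by move=> s0 [|//] _.
have := main N 0%N (fun=> 0%R) erefl; rewrite P1 mule1 => mainN.
apply: le_trans (mainN _ _); last 2 first.
- by split.
- exact: ltW.
have mp : measurable (past X 0 (fun=> 0%R)) by exact: measurable_past.
have PC : P (~` past X 0 (fun=> 0%R)) = 0.
  by rewrite probability_setC// P1 subee.
rewrite -[leRHS]adde0 -PC.
apply: le_trans (measureU2 _ _ _); last 2 first.
- exact: measurableI.
- exact: measurableC.
apply: le_measure; rewrite ?inE//.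
- by apply: measurableU; [exact: measurableI|exact: measurableC].
- move=> s sE; have [sp|sp] := pselect (past X 0 (fun=> 0%R) s); last by right.
  by left.
Qed.

Lemma past0_ae : P (~` past X 0 (fun=> 0%R)) = 0.
Proof.
have P1 : P (past X 0 (fun=> 0%R)) = 1.
  rewrite -(erw_start erw); congr (P _); apply/seteqP; split => s; first exact.
  by move=> s0 [|//] _.
by rewrite probability_setC ?P1 ?subee//; exact: measurable_past.
Qed.

(** The walk takes non-unit steps with probability zero, although its definition
    prescribes only probabilities of atoms: the unit-step atoms of the past keep
    the full mass at each time. *)
Lemma unit_steps :
  {ae P, forall s t, X t.+1 s = (X t s + 1)%R \/ X t.+1 s = (X t s - 1)%R}.
Proof.
apply: ae_foralln => t; pose unit := [set s | X t.+1 s = (X t s + 1)%R \/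
  X t.+1 s = (X t s - 1)%R].
have m_unit : measurable unit.
  have -> : unit = \bigcup_z ([set s | X t s = z] `&`
      ([set s | X t.+1 s = (z + 1)%R] `|` [set s | X t.+1 s = (z - 1)%R])).
    apply/seteqP; split => [s us|s [z _ [/= <-]]//].
    by exists (X t s).
  apply: countable_bigcupT_measurable => // z; apply: measurableI.
    exact: measurable_at.
  by apply: measurableU; exact: measurable_at.
have mE : measurable (~` unit) by exact: measurableC.
have main m k y : (k + m)%N = t.+1 ->
    (forall i, (i < k)%N -> y i.+1 = (y i + 1)%R \/ y i.+1 = (y i - 1)%R) ->
    P (~` unit `&` past X k y) = 0.
  elim: m k y => [|m IHm] k y kmt yS.
    rewrite (_ : _ `&` _ = set0) ?measure0//.
    apply/seteqP; split => // s [us sy]; apply: us.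
    by rewrite /unit /= !sy; [apply: yS|..]; lia.
  apply/eqP; rewrite eq_le measure_ge0 andbT.
  apply: le_trans (past_split _ _ mE) _.
  have stepE v : v = (y k + 1)%R \/ v = (y k - 1)%R ->
      P (~` unit `&` past X k.+1 (upd y k v)) = 0.
    move=> vE; apply: IHm => [|i]; first lia.
    rewrite ltnS leq_eqVlt => /orP[/eqP->|ik]; first by rewrite updS upd_le.
    by rewrite !upd_le ?(ltnW ik)//; exact: yS.
  by rewrite !stepE ?adde0//; [right|left].
exists (~` past X 0 (fun=> 0%R) `|` (~` unit `&` past X 0 (fun=> 0%R))); split.
- by apply: measurableU; [apply: measurableC|apply: measurableI => //];
    exact: measurable_past.
- apply/eqP; rewrite eq_le measure_ge0 andbT.
  apply: le_trans (measureU2 _ _ _) _.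
  + by apply: measurableC; exact: measurable_past.
  + by apply: measurableI => //; exact: measurable_past.
  + by rewrite [X in (X + _)%E]past0_ae [X in (_ + X)%E](main t.+1)// adde0.
- move=> s us; have [sp|sp] := pselect (past X 0 (fun=> 0%R) s); last by left.
  by right.
Qed.

End erw.

Lemma half_excess (n N L S : nat) (v : int) :
  v < n%:Z -> N%:Z = v + (2 * S)%N%:Z -> N = (n + 2 * L)%N -> (L <= S)%N.
Proof. by lia. Qed.

Section crossing.
Context d (T : measurableType d) {R : realType} (P : probability T R).
Context (X : nat -> T -> int) (M : nat) (p : R).
Hypothesis p01 : 1 / 2 <= p <= 1.
Hypothesis drift10 : 10 <= M%:R * (2 * p - 1).
Hypothesis erw : excited_random_walk P 0 (homogeneous_env M p) X.
Local Notation q := (cookie M p).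
Let q01 : forall c, 1 / 2 <= q c <= 1 := cookie01 M p01.

(** The value of [Esites] at time t along a path y, when n is the target and the
    sites down to - N - 1 are taken into account, which the walk cannot leave
    before time N. *)
Definition path_value w (G : nat -> R) (n N : nat) y t : \bar R :=
  Esites q w G (y t) (passes y t) (n + N.+1) (n%:Z - 1) 0 (lefts w y t).

Lemma path_value_ge0 w (G : nat -> R) (n N : nat) y t : (forall s, 0 <= G s) ->
  (0 <= path_value w G n N y t)%E.
Proof. by move=> G0; exact: Esites_ge0. Qed.

Lemma path_value0 w G n N : path_value w G n N (fun=> 0) 0 =
  fresh M p w G (n + N.+1) (n%:Z - 1) 0 0.
Proof.
rewrite /path_value /fresh /lefts big_ord0; congr Esites.
by apply/funext => k; rewrite /passes big_ord0.
Qed.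

Lemma path_value_step w (G : nat -> R) (n N : nat) y t : (forall s, 0 <= G s) ->
    below n%:Z y t -> y t < n%:Z -> (t < N)%N ->
  path_value w G n N y t =
  ((q (passes y t (y t)))%:E * path_value w G n N (upd y t (y t + 1)) t.+1 +
   (1 - q (passes y t (y t)))%:E * path_value w G n N (upd y t (y t - 1)) t.+1)%E.
Proof.
move=> G0 yt ytn tN; have := below_ge yt => yge.
rewrite /path_value (Esites_step q01)//; [|lia|lia].
rewrite !updS !passes_upd !lefts_upd eqxx mul1n.
by rewrite (_ : (y t + 1 == y t - 1) = false) ?mul0n ?addn0//; lia.
Qed.

Lemma path_value_done w (G : nat -> R) (n N : nat) y t :
    (forall s, 0 <= G s) -> y t = n%:Z ->
  path_value w G n N y t = (G (lefts w y t))%:E.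
Proof. by move=> G0 ytn; rewrite /path_value (Esites_done q01)// ytn; lia. Qed.

Definition timely (mu : nat -> R) (eps : R) n t :=
  `|t%:R - (n%:R + 2 * mu n)| <= eps * n%:R.

Definition untimely (mu : nat -> R) eps n : set T :=
  [set s | forall t, timely mu eps n t -> X t s <> n%:Z].

Lemma measurable_untimely mu eps n : measurable (untimely mu eps n).
Proof.
have -> : untimely mu eps n =
    \bigcap_(t in [set t | timely mu eps n t]) ~` [set s | X t s = n%:Z].
  by apply/seteqP; split => s h k; exact: h.
apply: bigcap_measurableType => // k _.
by apply: measurableC; exact: (measurable_at erw).
Qed.

(** Chebyshev's inequality for the three expectations of [fresh_bounds]: if the
    first visit to n is untimely then the left jumps from sites >= 0 are far from
    mu n or those from sites < 0 are many, and if there is no visit before time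
    N = n + 2 L then at least L left jumps were made. *)
Lemma untimely_le : exists (mu : nat -> R) (e : R),
  [/\ 0 <= e, (fun n => mu n / n%:R) @ \oo --> e &
  forall eps, 0 < eps -> exists C, forall n, (0 < n)%N ->
    (P (untimely mu eps n) <= (C / n%:R)%:E)%E].
Proof.
have [mu [e [K [e0 mu_e bounds]]]] := fresh_bounds p01 drift10.
exists mu, e; split => // eps eps0.
exists (K * (32 / eps ^+ 2 + 4 / eps + 1)) => n n0.
(* The mean of all left jumps is O(n), so waiting for n (n + 1) of them makes the
   probability of no visit O(1/n). *)
pose L := (n * n.+1)%N; pose N := (n + 2 * L)%N.
pose wr (k : int) : nat := (0 <= k)%R; pose wl (k : int) : nat := (k < 0)%R.
pose Gs s : R := (s%:R - mu n) ^+ 2.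
pose G1 s : R := s%:R.
have Gs0 s : 0 <= Gs s by exact: sqr_ge0.
have G10 s : 0 <= G1 s by exact: ler0n.
have nR : 0 < n%:R :> R by rewrite ltr0n.
(* T_n - n - 2 mu n is twice the sum of the deviation of the left jumps from
   sites >= 0 and the number of the others; if it exceeds eps n = 4 dl, then one
   of these two exceeds dl. *)
pose dl := eps * n%:R / 4.
have dl0 : 0 < dl by rewrite divr_gt0// mulr_gt0.
have L0 : (0 < L)%N by rewrite muln_gt0 n0.
have LR : 0 < L%:R :> R by rewrite ltr0n.
pose U y t : \bar R := ((dl ^- 2)%:E * path_value wr Gs n N y t +
  (dl^-1)%:E * path_value wl G1 n N y t +
  (L%:R^-1)%:E * path_value (fun=> 1%N) G1 n N y t)%E.
have c1 : 0 <= dl ^- 2 by rewrite invr_ge0 exprn_ge0// ltW.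
have c2 : 0 <= dl^-1 by rewrite invr_ge0 ltW.
have c3 : 0 <= L%:R^-1 :> R by rewrite invr_ge0 ltW.
have U1 y t : (0 <= (dl ^- 2)%:E * path_value wr Gs n N y t)%E.
  by rewrite mule_ge0 ?lee_fin ?path_value_ge0.
have U2 y t : (0 <= (dl^-1)%:E * path_value wl G1 n N y t)%E.
  by rewrite mule_ge0 ?lee_fin ?path_value_ge0.
have U3 y t : (0 <= (L%:R^-1)%:E * path_value (fun=> 1%N) G1 n N y t)%E.
  by rewrite mule_ge0 ?lee_fin ?path_value_ge0.
pose ok t : bool := `|t%:R - (n%:R + 2 * mu n)| <= eps * n%:R.
apply: (@le_trans _ _ (P (misses X n ok N))).
  apply: le_measure; rewrite ?inE.
  - exact: measurable_untimely.
  - exact: (measurable_misses erw).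
  - by move=> s h t _; exact: h.
have omegaE x c : homogeneous_env M p x c.+1 = q c by [].
apply: (@le_trans _ _ (U (fun=> 0) 0%N)).
  apply: (misses_le q01 omegaE erw (U := U)) => //.
  - by move=> y t; rewrite !adde_ge0.
  - move=> y t yt ytn notok; rewrite /U !path_value_done// -!EFinM -!EFinD lee_fin.
    have tE : t%:Z = n%:Z + (2 * (lefts wr y t + lefts wl y t))%N%:Z.
      by have := below_time yt; rewrite lefts_split ytn.
    move: tE notok; rewrite /ok.
    move: (lefts wr y t) (lefts wl y t) (lefts (fun=> 1%N) y t) => a b c tE.
    have -> : t%:R = n%:R + 2 * (a%:R + b%:R) :> R.
      have -> : t = (n + 2 * (a + b))%N.
        by apply/eqP; rewrite -eqz_nat tE PoszD.
      by rewrite natrD natrM natrD.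
    rewrite -ltNge => big.
    have b0 : 0 <= b%:R :> R by [].
    have third : 0 <= L%:R^-1 * G1 c by rewrite mulr_ge0.
    suff : 1 <= dl ^- 2 * Gs a + dl^-1 * G1 b by lra.
    have [bdl|bdl] := leP dl b%:R.
      have : 1 <= dl^-1 * G1 b by rewrite mulrC ler_pdivlMr// mul1r.
      by have : 0 <= dl ^- 2 * Gs a; [exact: mulr_ge0|lra].
    have : 1 <= dl ^- 2 * Gs a; last first.
      by have : 0 <= dl^-1 * G1 b; [exact: mulr_ge0|lra].
    rewrite mulrC ler_pdivlMr ?exprn_gt0// mul1r /Gs -[leRHS]real_normK ?num_real//.
    rewrite lerXn2r ?nnegrE ?(ltW dl0)//.
    have : `|n%:R + 2 * (a%:R + b%:R) - (n%:R + 2 * mu n)| <=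
        2 * `|a%:R - mu n| + 2 * b%:R.
      have -> : n%:R + 2 * (a%:R + b%:R) - (n%:R + 2 * mu n) =
        2 * (a%:R - mu n) + 2 * b%:R by ring.
      apply: le_trans (ler_normD _ _) _.
      by rewrite !normrM !normr_nat.
    by move: big bdl; rewrite /dl; lra.
  - move=> y yN yNn; apply: (@le_trans _ _
      ((L%:R^-1)%:E * path_value (fun=> 1%N) G1 n N y N)%E); last first.
      by rewrite /U leeDr// adde_ge0.
    have := Esites_ge q01 (fun=> 1%N) G10 (y N) (passes y N) (n + N.+1) (n%:Z - 1) 0
       (lefts (fun=> 1%N) y N).
    have hG : {homo G1 : i j / (i <= j)%N >-> i <= j} by move=> i j; rewrite ler_nat.
    move=> /(_ hG) /(lee_wpmul2l (_ : 0 <= L%:R^-1%:E)%E) => h.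
    apply: le_trans (h _); last by rewrite lee_fin.
    rewrite -EFinM lee_fin mulrC ler_pdivlMr// mul1r ler_nat.
    exact: half_excess yNn (below_time yN) erefl.
  - move=> y t yt ytn tN; rewrite /U.
    rewrite (path_value_step _ Gs0 yt ytn tN) (path_value_step wl G10 yt ytn tN).
    rewrite (path_value_step (fun=> 1%N) G10 yt ytn tN).
    have /andP[q0 q1] := q01 (passes y t (y t)).
    have Q0 : (0 <= (q (passes y t (y t)))%:E)%E by rewrite lee_fin; lra.
    have Q1 : (0 <= (1 - q (passes y t (y t)))%:E)%E by rewrite lee_fin; lra.
    rewrite le_eqVlt; apply/orP; left; apply/eqP.
    rewrite !ge0_muleDr ?adde_ge0 ?mule_ge0 ?path_value_ge0//.
    rewrite !(muleCA (q _)%:E) !(muleCA (1 - q _)%:E).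
    by rewrite [LHS]addeACA [X in (X + _)%E]addeACA.
rewrite /U !path_value0.
have [b1 b2 b3] := bounds n N.+1.
apply: (@le_trans _ _ ((dl ^- 2)%:E * (K * n.+1%:R)%:E + dl^-1%:E * K%:E +
   L%:R^-1%:E * (K * n.+1%:R)%:E)%E).
  by apply: leeD; [apply: leeD|]; apply: lee_wpmul2l; rewrite ?lee_fin.
rewrite -!EFinM -!EFinD lee_fin.
have K0 : 0 <= K.
  rewrite -lee_fin; apply: le_trans b2; exact: Esites_ge0.
have n1 : 1 <= n%:R :> R by rewrite ler1n.
rewrite /dl /L natrM -(@natr1 _ n).
have -> : (eps * n%:R / 4) ^- 2 * (K * (n%:R + 1)) + (eps * n%:R / 4)^-1 * K +
    (n%:R * (n%:R + 1))^-1 * (K * (n%:R + 1)) =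
  K * (16 * (n%:R + 1) / n%:R / eps ^+ 2 + 4 / eps + 1) / n%:R.
  by field; rewrite !lt0r_neq0//; lra.
rewrite ler_pM2r ?invr_gt0// ler_wpM2l// !lerD2r ler_pM2r ?invr_gt0 ?exprn_gt0//.
rewrite ler_pdivrMr//; lra.
Qed.

End crossing.

(** * Crossing times determine the speed *)

Section deterministic.
Context {R : realType}.

Lemma unit_steps_lipschitz (x : nat -> int) s t :
    (forall i, x i.+1 = x i + 1 \/ x i.+1 = x i - 1) ->
  `|(x s)%:~R - (x t)%:~R| <= `|s%:R - t%:R| :> R.
Proof.
move=> xS; wlog st : s t / (s <= t)%N.
  move=> h; have [/h//|/ltnW/h] := leqP s t.
  by rewrite distrC [leRHS]distrC.
have [m ->] : exists m, t = (s + m)%N by exists (t - s)%N; lia.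
have -> : s%:R - (s + m)%:R = - m%:R :> R by rewrite natrD; ring.
rewrite normrN normr_nat; elim: m => [|m IHm]; first by rewrite addn0 subrr normr0.
rewrite addnS -(@natr1 _ m).
have [->|->] := xS (s + m)%N; rewrite ?rmorphD ?rmorphB/= ?rmorph1;
  move: IHm; move: ((x (s + m)%N)%:~R : R) ((x s)%:~R : R) => b a ab.
  have := ler_distD b a (b + 1).
  by have -> : b - (b + 1) = -1 by [ring]; rewrite normrN1; lra.
have := ler_distD b a (b - 1).
by have -> : b - (b - 1) = 1 by [ring]; rewrite normr1; lra.
Qed.

Lemma square_bracket (a : R) : 0 <= a ->
  exists k : nat, k%:R ^+ 2 <= a < (k%:R + 1) ^+ 2.
Proof.
move=> a0; exists (Num.truncn (Num.sqrt a)).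
have /andP[h1 h2] := truncn_itv (sqrtr_ge0 a).
rewrite -(@natr1 _ (Num.truncn _)) in h2.
move: h1 h2 (sqrtr_ge0 a) (sqr_sqrtr a0).
move: (Num.truncn (Num.sqrt a)) => k; move: (Num.sqrt a) => r h1 h2 r0 <-.
by rewrite lerXn2r ?ltrXn2r ?nnegrE ?addr_ge0.
Qed.

(** Compare t with c k^2, where k^2 <= t / c < (k + 1)^2: the visit to k^2 occurs
    at distance o(t) from t, and the position changes at most by that distance. *)
Lemma speed_of_crossings (x : nat -> int) (c : R) : 1 <= c ->
    (forall i, x i.+1 = x i + 1 \/ x i.+1 = x i - 1) ->
    (forall eps, 0 < eps -> \forall k \near \oo,
      exists t, x t = (k ^ 2)%N%:Z /\ `|t%:R - c * k%:R ^+ 2| <= eps * k%:R ^+ 2) ->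
  (fun t => (x t)%:~R / t%:R) @ \oo --> c^-1.
Proof.
move=> c1 xS cross; apply/cvgrPdist_le => eps eps0.
have eps20 : 0 < eps / 2 by lra.
have [K0 _ HK] := cross _ eps20.
(* Beyond K1 the distance 3 (c + 1) k between consecutive squares, in time and in
   space, is at most eps / 2 * k ^ 2. *)
pose K1 := (maxn K0 (Num.truncn (3 * (c + 1) / (eps / 2))).+1).
have K1lt : 3 * (c + 1) / (eps / 2) < K1%:R.
  by rewrite (lt_le_trans (truncnS_gt _))// ler_nat leq_maxr.
have c0 : 0 < c by lra.
near=> t.
have t0 : 0 < t%:R :> R by rewrite ltr0n; near: t; exact: nbhs_infty_gt.
have tK : c * (K1%:R + 1) ^+ 2 <= t%:R.
  by near: t; exact: nbhs_infty_ger.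
have tc0 : 0 <= t%:R / c by rewrite divr_ge0// ltW.
have [k /andP[k1 k2]] := square_bracket tc0.
have kK : (K1 <= k)%N.
  rewrite -(@ler_nat R) -(lerD2r 1) -(@ler_pXn2r _ 2)// ?nnegrE ?addr_ge0//.
  by rewrite (le_trans _ (ltW k2))// ler_pdivlMr// mulrC.
have [m [xm mk]] := HK k (leq_trans (leq_maxl _ _) kK).
have lip := unit_steps_lipschitz t m xS.
have kR : 1 <= k%:R :> R by rewrite ler1n (leq_trans _ kK)// /K1 leq_max orbT.
have kbig : 3 * (c + 1) <= eps / 2 * k%:R.
  rewrite [leRHS]mulrC -ler_pdivrMr//; apply: ltW; apply: lt_le_trans K1lt _.
  by rewrite ler_nat.
rewrite xm in lip.
have kk : ((k ^ 2)%N%:Z)%:~R = k%:R ^+ 2 :> R by rewrite -natrX.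
rewrite kk in lip.
have tk1 : c * k%:R ^+ 2 <= t%:R by rewrite [leLHS]mulrC -ler_pdivlMr.
have tk2 : t%:R <= c * (k%:R + 1) ^+ 2 by rewrite [leRHS]mulrC -ler_pdivrMr// ltW.
have -> : c^-1 - (x t)%:~R / t%:R = (t%:R / c - (x t)%:~R) / t%:R.
  by field; rewrite !lt0r_neq0.
rewrite normrM normfV (gtr0_norm t0) ler_pdivrMr//.
have d1 : `|t%:R / c - k%:R ^+ 2| <= 2 * k%:R + 1.
  by rewrite ger0_norm ?subr_ge0//; lra.
have d2 : `|t%:R - m%:R| <= c * (2 * k%:R + 1) + eps / 2 * k%:R ^+ 2.
  apply: le_trans (ler_distD (c * k%:R ^+ 2) _ _) _.
  apply: lerD; last by rewrite distrC.
  by rewrite ger0_norm ?subr_ge0//; lra.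
have d3 := ler_distD (k%:R ^+ 2) (t%:R / c) ((x t)%:~R : R).
rewrite [X in _ <= _ + X]distrC in d3.
have d4 : 3 * (c + 1) * k%:R <= eps / 2 * k%:R * k%:R by rewrite ler_wpM2r.
have d5 : eps * (c * k%:R ^+ 2) <= eps * t%:R by rewrite ler_wpM2l// ltW.
have d6 : eps * k%:R ^+ 2 <= eps * (c * k%:R ^+ 2).
  by rewrite ler_wpM2l ?(ltW eps0)// ler_peMl// sqr_ge0.
have d7 : (c + 1) * (2 * k%:R + 1) <= (c + 1) * (3 * k%:R).
  by rewrite ler_wpM2l//; lra.
lra.
Unshelve. all: by end_near. Qed.

End deterministic.

Lemma sum_inv_square_le (R : realType) n :
  \sum_(0 <= k < n) k.+1%:R ^- 2 <= 2 :> R.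
Proof.
suff h : \sum_(0 <= k < n.+1) k.+1%:R ^- 2 <= 2 - n.+1%:R^-1 :> R.
  apply: (@le_trans _ _ (\sum_(0 <= k < n.+1) k.+1%:R ^- 2)).
    by rewrite big_nat_recr//= lerDl invr_ge0 sqr_ge0.
  by apply: le_trans h _; rewrite gerBl invr_ge0.
elim: n => [|n IHn]; first by rewrite big_nat1 invr1 expr1n invr1; lra.
rewrite big_nat_recr//=.
have n1 : 1 <= n.+1%:R :> R by rewrite ler1n.
have step : n.+2%:R ^- 2 <= n.+1%:R^-1 - n.+2%:R^-1 :> R.
  rewrite -(@natr1 _ n.+1); move: (n.+1%:R : R) n1 => v v1.
  rewrite -subr_ge0.
  have -> : v^-1 - (v + 1)^-1 - (v + 1) ^- 2 = (v * (v + 1) ^+ 2)^-1.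
    by field; rewrite !lt0r_neq0//; lra.
  by rewrite invr_ge0 mulr_ge0 ?sqr_ge0//; lra.
by apply: le_trans (lerD IHn step) _; rewrite addrA subrK.
Qed.

(** Borel-Cantelli for the untimely crossings of the squares (k + 1)^2, for each
    tolerance 1 / (i + 1).  The limit of T_n / n is c = 1 + 2 e, where e is the
    limit of mu n / n. *)
Lemma speed_positive (d : measure_display) (T : measurableType d) (R : realType)
    (P : probability T R) (X : nat -> T -> int) (M : nat) (p : R) :
    1 / 2 <= p <= 1 -> 10 <= M%:R * (2 * p - 1) ->
    excited_random_walk P 0 (homogeneous_env M p) X ->
  exists v : R, 0 < v /\ has_speed P X v.
Proof.
move=> p01 drift10 erw.
have [mu [e [e0 mu_e timely_le]]] := untimely_le p01 drift10 erw.
pose c := 1 + 2 * e.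
have c1 : 1 <= c by rewrite /c; lra.
exists c^-1; split; first by rewrite invr_gt0; lra.
pose late i k := untimely X mu i.+1%:R^-1 (k.+1 ^ 2).
have late_measurable i k : measurable (late i k) by exact: (measurable_untimely erw).
have late_null i : P (lim_sup_set (late i)) = 0%E.
  apply: lim_sup_set_cvg0 => //.
  have i0 : 0 < i.+1%:R^-1 :> R by rewrite invr_gt0.
  have [C HC] := timely_le _ i0.
  have C0 : 0 <= C.
    have := le_trans (measure_ge0 _ _) (HC 1%N isT).
    by rewrite lee_fin divr1.
  apply: (@le_lt_trans _ _ (C * 2)%:E); last exact: ltry.
  apply: lime_le; first by apply: is_cvg_nneseries.
  apply: nearW => n.
  apply: (@le_trans _ _ (\sum_(0 <= k < n) (C * k.+1%:R ^- 2)%:E)%E).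
    by apply: lee_sum => k _; rewrite -natrX; apply: HC; rewrite expn_gt0.
  by rewrite sumEFin lee_fin -mulr_sumr ler_wpM2l// sum_inv_square_le.
have late_ae : {ae P, forall s i, ~ lim_sup_set (late i) s}.
  apply: ae_foralln => i; exists (lim_sup_set (late i)); split.
  - apply: bigcap_measurableType => k _.
    by apply: bigcup_measurable => j _; exact: late_measurable.
  - exact: late_null.
  - by move=> s /=; rewrite notK.
apply: filterS2 (unit_steps (cookie01 M p01) (fun _ _ => erefl) erw) late_ae.
move=> s steps on_time; apply: speed_of_crossings => // eps eps0.
have [i ieps] : exists i, i.+1%:R^-1 <= eps / 2.
  exists (Num.truncn (eps / 2)^-1); rewrite -[leRHS]invrK lef_pV2 ?posrE ?invr_gt0//.
    exact/ltW/truncnS_gt.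
  by lra.
have [N1 HN1] : exists N1, forall k, (N1 <= k)%N -> ~ late i k s.
  apply: contrapT => h; apply: (on_time i) => N1 _.
  apply: contrapT => h1; apply: h; exists N1 => k k1 ks; apply: h1.
  by exists k.
move/cvgrPdist_le : mu_e => /(_ (eps / 4)) []; first lra.
move=> N2 _ HN2.
exists (maxn N1 N2).+1 => // -[//|k] /=; rewrite ltnS geq_max => /andP[k1 k2].
have [t [timely_t Xt]] : exists t, timely mu i.+1%:R^-1 (k.+1 ^ 2) t /\
    X t s = (k.+1 ^ 2)%N%:Z.
  apply: contrapT => h; apply: (HN1 k k1) => t tt Xt; apply: h.
  by exists t.
exists t; split => //.
have n0 : 0 < (k.+1 ^ 2)%N%:R :> R by rewrite ltr0n expn_gt0.
have : `|e - mu (k.+1 ^ 2)%N / (k.+1 ^ 2)%N%:R| <= eps / 4.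
  by apply: HN2 => /=; nia.
rewrite -natrX; move: timely_t; rewrite /timely.
move: (k.+1 ^ 2)%N n0 => n n0 t_n mu_n.
have {}mu_n : `|mu n - e * n%:R| <= eps / 4 * n%:R.
  have -> : mu n - e * n%:R = - (e - mu n / n%:R) * n%:R.
    by field; rewrite lt0r_neq0.
  by rewrite normrM normrN (gtr0_norm n0) ler_wpM2r// ltW.
have i_n : i.+1%:R^-1 * n%:R <= eps / 2 * n%:R by rewrite ler_wpM2r// ltW.
apply: le_trans (ler_distD (n%:R + 2 * mu n) _ _) _.
have -> : n%:R + 2 * mu n - c * n%:R = 2 * (mu n - e * n%:R) by rewrite /c; ring.
rewrite [X in _ + X]normrM normr_nat.
have {t_n i_n} t_n := le_trans t_n i_n.
move: (`|t%:R - _|) (`|mu n - _|) t_n mu_n => a b a_n b_n; lra.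
Qed.

Theorem theorem1p2 (R : realType) :
  exists C0 eps0 : R,
    1 < C0 /\ 0 < eps0 < 1 / 2 /\
    forall (p : R) (M : nat),
      1 / 2 < p <= 1 / 2 + eps0 -> (0 < M)%N -> C0 <= M%:R * (2 * p - 1) ->
      forall (d : measure_display) (T : measurableType d)
        (P : probability T R) (X : nat -> T -> int),
        excited_random_walk P 0 (homogeneous_env M p) X ->
        exists v : R, 0 < v /\ has_speed P X v.
Proof.
exists 10, (1 / 4); split; first lra.
split; first by apply/andP; split; lra.
move=> p M /andP[p_gt p_le] _ drift10 d T P X.
by apply: speed_positive => //; apply/andP; split; lra.
Qed.
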